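(* Let $\|\cdot\|$ be a norm on $c_{00}(\mathbb{N})$ with respect to which the unit vector basis $(e_i)_i$ is conditional spreading. Then there exist two norms $\|\cdot\|_u$ and $\|\cdot\|_c$, both defined on $c_{00}(\mathbb{N})$, satisfying the following. (i) The unit vector basis $(e_i)_i$ is subsymmetric with respect to $\|\cdot\|_u$. (ii) The unit vector basis $(e_i)_i$ is conditional and convex block homogeneous with respect to $\|\cdot\|_c$. (iii) There exist positive constants $\kappa$ and $K$ such that for every $x\in c_{00}(\mathbb{N})$ $$\kappa\max\{\|x\|_u,\|x\|_c\}\leqslant\|x\|\leqslant K\max\{\|x\|_u,\|x\|_c\}.$$
   Context: Banach spaces and scalars are real; $c_{00}(\mathbb{N})$ is the space of finitely supported real sequences. Two sequences are equivalent if the norms of their finite linear combinations with the same coefficients are comparable up to uniform positive constants. A sequence is spreading if it is equivalent to all of its subsequences. A sequence is conditional spreading if it is a Schauder basic spreading sequence that is not unconditional; ''conditional'' means not unconditional. A sequence is subsymmetric if it is unconditional and spreading. A convex block sequence of $(x_i)_i$ is a sequence $(w_k)_k$ of the form $w_k=\sum_{i\in F_k}c_ix_i$, where $F_1<F_2<\cdots$ are successive finite subsets of $\mathbb{N}$, $c_i\geqslant0$ and $\sum_{i\in F_k}c_i=1$. A Schauder basic sequence is convex block homogeneous if it is equivalent to each of its convex block sequences. *)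

(* Defs.v *)
From HB Require Import structures.
From mathcomp Require Import all_boot all_order all_algebra.
From mathcomp Require Import finmap.
From mathcomp Require Import all_classical all_reals all_analysis.
Set Implicit Arguments.
Unset Strict Implicit.
Unset Printing Implicit Defensive.
Import Order.TTheory GRing.Theory Num.Theory.
Import numFieldNormedType.Exports.
Local Open Scope classical_set_scope.
Local Open Scope ring_scope.

Definition finitely_supported (R : realType) : {pred nat -> R} :=
  [pred x : nat -> R | `[< finite_set [set i | x i != 0] >]].

Record c00 (R : realType) := C00 {
  c00_val :> nat -> R;
  c00P : c00_val \in @finitely_supported R
}.

HB.instance Definition _ (R : realType) := [isSub for @c00_val R].
HB.instance Definition _ (R : realType) := [Choice of c00 R by <:].

Lemma finitely_supported_submod (R : realType) :
  submod_closed (@finitely_supported R).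
Proof.
split=> [|a x y /asboolP xfin /asboolP yfin]; apply/asboolP.
  by apply: (sub_finite_set _ (finite_set0 nat)) => i /=; rewrite eqxx.
have xyfin : finite_set ([set i | x i != 0] `|` [set i | y i != 0]).
  by rewrite finite_setU.
apply: (sub_finite_set _ xyfin) => i /= nz.
have [xi0|] := eqVneq (x i) 0; last by left.
right; apply: contra_neq nz => yi0.
by rewrite /GRing.add /GRing.scale /= xi0 yi0 scaler0 addr0.
Qed.

HB.instance Definition _ (R : realType) :=
  GRing.isSubmodClosed.Build R (nat -> R) (@finitely_supported R)
    (@finitely_supported_submod R).
HB.instance Definition _ (R : realType) :=
  [SubChoice_isSubLmodule of c00 R by <:].

Lemma unit_vector_subproof (R : realType) (i : nat) :
  (fun j => (j == i)%:R : R) \in @finitely_supported R.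
Proof.
apply/asboolP; apply: (sub_finite_set _ (finite_set1 i)) => j /=.
by case: (j =P i) => // _; rewrite eqxx.
Qed.

Definition unit_vector (R : realType) (i : nat) : c00 R :=
  C00 (unit_vector_subproof R i).

(* Norms are functions rather than [normedModType] structures because several
   of them are considered on one and the same vector space. *)
Record is_norm (R : realType) (V : lmodType R) (N : V -> R) : Prop := IsNorm {
  is_normD : forall x y, N (x + y) <= N x + N y;
  is_normZ : forall (a : R) x, N (a *: x) = `|a| * N x;
  is_norm0_eq0 : forall x, N x = 0 -> x = 0
}.

Definition norm_cauchy (R : realType) (V : lmodType R) (N : V -> R)
    (u : nat -> V) : Prop :=
  forall eps : R, 0 < eps ->
    \forall m \near \oo & n \near \oo, N (u m - u n) < eps.

Definition in_span (R : realType) (V : lmodType R) (x : nat -> V) (v : V) :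
    Prop :=
  exists (n : nat) (a : nat -> R), v = \sum_(i < n) a i *: x i.

(* [x] is a Schauder basis of its closed linear span in the completion of
   [(V, N)]. A point of this closed span is given by an [N]-Cauchy sequence [y]
   in the linear span of [x]; the series [sum_i a_i x_i] converges to that
   point iff its partial sums are asymptotic to [y]. *)
Definition schauder_basic (R : realType) (V : lmodType R) (N : V -> R)
    (x : nat -> V) : Prop :=
  forall y : nat -> V, (forall k, in_span x (y k)) -> norm_cauchy N y ->
    exists! a : nat -> R,
      N (y n - \sum_(i < n) a i *: x i) @[n --> \oo] --> (0 : R).

(* The expansions converge unconditionally, i.e. under every rearrangement;
   convergence of a series in the completion of [(V, N)] means that its partial
   sums are [N]-Cauchy. *)
Definition unconditional (R : realType) (V : lmodType R) (N : V -> R)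
    (x : nat -> V) : Prop :=
  schauder_basic N x /\
  forall a : nat -> R,
    norm_cauchy N (fun n => \sum_(i < n) a i *: x i) ->
    forall p : nat -> nat, bijective p ->
      norm_cauchy N (fun n => \sum_(i < n) a (p i) *: x (p i)).

Definition conditional (R : realType) (V : lmodType R) (N : V -> R)
    (x : nat -> V) : Prop :=
  ~ unconditional N x.

Definition equivalent (R : realType) (V : lmodType R) (N : V -> R)
    (x y : nat -> V) : Prop :=
  exists c C : R, [/\ 0 < c, 0 < C &
    forall (n : nat) (a : nat -> R),
      c * N (\sum_(i < n) a i *: x i) <= N (\sum_(i < n) a i *: y i) /\
      N (\sum_(i < n) a i *: y i) <= C * N (\sum_(i < n) a i *: x i)].

Definition spreading (R : realType) (V : lmodType R) (N : V -> R)
    (x : nat -> V) : Prop :=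
  forall s : nat -> nat, {homo s : m n / (m < n)%N} ->
    equivalent N x (x \o s).

Definition conditional_spreading (R : realType) (V : lmodType R) (N : V -> R)
    (x : nat -> V) : Prop :=
  [/\ schauder_basic N x, spreading N x & conditional N x].

Definition subsymmetric (R : realType) (V : lmodType R) (N : V -> R)
    (x : nat -> V) : Prop :=
  unconditional N x /\ spreading N x.

(* The [F k] are nonempty since the weights over [F k] sum to 1, so comparing
   consecutive ones suffices for [F 0 < F 1 < ...]. *)
Definition convex_block_sequence (R : realType) (V : lmodType R)
    (x w : nat -> V) : Prop :=
  exists (F : nat -> {fset nat}) (c : nat -> R),
    [/\ forall k i j, i \in F k -> j \in F k.+1 -> (i < j)%N,
        forall k i, i \in F k -> 0 <= c i,
        forall k, \sum_(i <- F k) c i = 1 &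
        forall k, w k = \sum_(i <- F k) c i *: x i].

Definition convex_block_homogeneous (R : realType) (V : lmodType R)
    (N : V -> R) (x : nat -> V) : Prop :=
  schauder_basic N x /\
  forall w : nat -> V, convex_block_sequence x w -> equivalent N x w.

(* Main.v *)
From HB Require Import structures.
Require Import Defs.
From mathcomp Require Import all_boot all_order all_algebra.
From mathcomp Require Import finmap zify ring lra.
From mathcomp Require Import all_classical all_reals all_analysis.
Set Implicit Arguments.
Unset Strict Implicit.
Unset Printing Implicit Defensive.
Import Order.TTheory GRing.Theory Num.Theory.
Import numFieldNormedType.Exports.
Local Open Scope classical_set_scope.
Local Open Scope ring_scope.

(* Identify c00 with the polynomials: e_i is 'X^i, a right shift is the
   multiplication by a power of 'X, the summing functional is the evaluation at
   1, and with A_n = (1 + 'X + ... + 'X^(n-1)) / n one has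
   ('X - 1) A_n = ('X^n - 1) / n, so that A_n z is small in norm, uniformly under
   shifts, as soon as z(1) = 0. Replacing blocks of a vector by averages of
   their shifts does not increase the norm, up to the spreading constant C.

   - Averaging away some of the blocks shows that sequences of shifts of a
     fixed z with z(1) = 0 are unconditional; for z = 1 - 'X this is the norm
     |p|_u = | p('X^2) (1 - 'X) |.
   - If the summing functional were unbounded, e_i could be replaced by
     e_i - x with x(1) = 1 and x small, and the basis would be unconditional.
   - |p|_c = limsup_n | p('X^(2n)) A_n |. Up to constants it is the smallest
     norm obtained by replacing the e_i by successive blocks of sum 1, hence
     convex block homogeneity.
   - 1 = A_n + (1 - A_n), where 1 - A_n is an average of the 1 - 'X^t, gives
     |p| <= C |p|_c + C^2 |p|_u.
   - If |.|_c were unconditional, then, since it dominates the summing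
     functional, every series converging for |.| would converge absolutely,
     and |.| would be unconditional.

   The partial sum projections are bounded because otherwise the A_n would form
   a Cauchy sequence, whose expansion would be invariant under the shift, hence
   zero. *)

(** * Bases of a normed space *)

Section Norm.
Variables (R : realType) (V : lmodType R) (N : V -> R) (N_norm : is_norm N).
Implicit Types (u v w : V) (x : nat -> V) (a : nat -> R).

Lemma norm0 : N 0 = 0.
Proof. by have := is_normZ N_norm 0 0; rewrite scale0r normr0 mul0r. Qed.

Lemma normN v : N (- v) = N v.
Proof. by rewrite -scaleN1r (is_normZ N_norm) normrN1 mul1r. Qed.

Lemma normB u v : N (u - v) <= N u + N v.
Proof. by rewrite -[N v]normN; exact: is_normD. Qed.

Lemma norm_distC u v : N (u - v) = N (v - u).
Proof. by rewrite -opprB normN. Qed.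

Lemma norm_ge0 v : 0 <= N v.
Proof. by have := normB v v; rewrite subrr norm0; lra. Qed.

Lemma norm_gt0 v : v != 0 -> 0 < N v.
Proof.
move=> v0; rewrite lt0r norm_ge0 andbT.
by apply: contra_neq v0; exact: is_norm0_eq0.
Qed.

Lemma norm_le_sub u v : N u <= N (u - v) + N v.
Proof. by rewrite -{1}[u](subrK v); exact: is_normD. Qed.

Lemma norm_sum (I : Type) (r : seq I) (P : pred I) (F : I -> V) :
  N (\sum_(i <- r | P i) F i) <= \sum_(i <- r | P i) N (F i).
Proof.
elim/big_ind2: _ => [|a b c d ab cd|//]; first by rewrite norm0.
by apply: le_trans (is_normD N_norm _ _) _; exact: lerD.
Qed.

Lemma norm_cauchyP (u : nat -> V) :
  norm_cauchy N u <-> forall eps : R, 0 < eps ->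
    exists n0 : nat, forall m n, (n0 <= m <= n)%N -> N (u n - u m) < eps.
Proof.
split=> [cu eps e0|cu eps e0].
  have := cu _ e0.
  case=> -[A B] /= [[a _ Aa] [b _ Bb]] AB.
  exists (maxn a b) => m n; rewrite geq_max => /andP[/andP[am bm] mn].
  rewrite norm_distC.
  by apply: (AB (m, n)); split => /=; [apply: Aa | apply: Bb] => //=; lia.
have [n0 H] := cu _ e0.
exists ([set m | n0 <= m]%N, [set n | n0 <= n]%N).
  by split; exact: nbhs_infty_ge.
move=> [m n] [/= n0m n0n].
have [mn|/ltnW nm] := leqP m n; last by apply: H; rewrite n0n.
by rewrite norm_distC; apply: H; rewrite n0m.
Qed.

Lemma norm_null_seqP (u : nat -> V) :
  (N (u n) @[n --> \oo] --> (0 : R)) <-> forall eps : R, 0 < eps ->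
    exists n0 : nat, forall n, (n0 <= n)%N -> N (u n) < eps.
Proof.
split=> [cu eps e0|cu].
  move/cvgrPdist_lt : cu => /(_ _ e0) [n0 _ H].
  exists n0 => n n0n; have := H n n0n.
  by rewrite /= sub0r normrN ger0_norm// norm_ge0.
apply/cvgrPdist_lt => eps e0; have [n0 H] := cu _ e0.
exists n0 => // n /= n0n.
by rewrite sub0r normrN ger0_norm ?norm_ge0// H.
Qed.

End Norm.

Lemma real_cauchy_cvg (R : realType) (c : nat -> R) :
  (forall eps : R, 0 < eps -> exists n0 : nat, forall n, (n0 <= n)%N ->
    `|c n0 - c n| < eps) ->
  exists l, forall eps : R, 0 < eps -> exists n0 : nat, forall n, (n0 <= n)%N ->
    `|l - c n| < eps.
Proof.
move=> cc; have /cauchy_cvgP/cvg_ex[l cl] : cauchy (c @ \oo).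
  apply: cauchy_exP => eps e0; have [n0 H] := cc _ e0.
  by exists (c n0), n0 => // n /= n0n; exact: H.
exists l => eps e0; move/cvgrPdist_lt : cl => /(_ _ e0)[n0 _ H].
by exists n0 => n n0n; exact: H.
Qed.

Lemma sum_ordB (V : zmodType) (F : nat -> V) m n : (m <= n)%N ->
  \sum_(i < n) F i - \sum_(i < m) F i = \sum_(m <= i < n) F i.
Proof.
move=> mn; rewrite -!(big_mkord xpredT F) (big_cat_nat (leq0n m) mn)/=.
by rewrite [X in X - _]addrC addrK.
Qed.

Section Basis.
Variables (R : realType) (V : lmodType R) (N : V -> R) (N_norm : is_norm N).
Variable (x : nat -> V).
Implicit Types (a : nat -> R).

Lemma schauder_basic_of_bounded_projections (B : R) :
  (forall i, x i != 0) ->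
  (forall a m n, (m <= n)%N ->
     N (\sum_(i < m) a i *: x i) <= B * N (\sum_(i < n) a i *: x i)) ->
  schauder_basic N x.
Proof.
move=> x0 projB y y_span /norm_cauchyP-/(_ N_norm) y_cauchy.
pose S a n := \sum_(i < n) a i *: x i.
have SB a b n : S a n - S b n = S (fun i => a i - b i) n.
  by rewrite /S -sumrB; apply: eq_bigr => i _; rewrite scalerBl.
have Nx i : 0 < N (x i) by exact: norm_gt0.
have B0 : 0 <= B.
  have := projB (fun=> 1) 1 1 (leqnn _); rewrite big_ord1 scale1r.
  by have := Nx 0%N; nra.
have coordB a i n : (i < n)%N -> `|a i| * N (x i) <= 2 * B * N (S a n).
  move=> i_n; have -> : `|a i| * N (x i) = N (S a i.+1 - S a i).
    by rewrite -(is_normZ N_norm) /S big_ord_recr /= [X in X - _]addrC addrK.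
  apply: le_trans (normB N_norm _ _) _.
  have := projB a _ _ i_n; have := projB a _ _ (ltnW i_n); rewrite -!/(S _ _).
  lra.
have /choice[b Hb] : forall k, exists b : nat -> R,
    exists n0 : nat, forall n, (n0 <= n)%N -> y k = S b n.
  move=> k; have [n [a ->]] := y_span k.
  exists (fun i => if (i < n)%N then a i else 0), n => m nm.
  rewrite /S (big_ord_widen_cond m xpredT (fun i => a i *: x i) nm) big_mkcond.
  by apply: eq_bigr => i _ /=; case: ifP; rewrite ?scale0r.
have yB k l : exists n0 : nat, forall n, (n0 <= n)%N ->
    y k - y l = S (fun i => b k i - b l i) n.
  have [n1 H1] := Hb k; have [n2 H2] := Hb l.
  exists (maxn n1 n2) => n; rewrite geq_max => /andP[n1n n2n].
  by rewrite -SB -H1// -H2.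
have projBy k l n : N (S (b k) n - S (b l) n) <= B * N (y k - y l).
  have [n0 /(_ (maxn n0 n) (leq_maxl _ _)) ->] := yB k l.
  by rewrite SB; apply: projB; exact: leq_maxr.
have /choice[a Ha] : forall i, exists l : R, forall eps : R, 0 < eps ->
    exists n0 : nat, forall k, (n0 <= k)%N -> `|l - b k i| < eps.
  move=> i; apply: real_cauchy_cvg => eps e0.
  have B1 : 0 < 2 * B + 1 by lra.
  have e'0 : 0 < eps * N (x i) / (2 * B + 1) by rewrite divr_gt0// mulr_gt0.
  have [n0 H] := y_cauchy _ e'0.
  exists n0 => k n0k; have /H : (n0 <= n0 <= k)%N by rewrite leqnn.
  rewrite ltr_pdivlMr// norm_distC// => lt_eps.
  have [n1 /(_ (maxn n1 i.+1) (leq_maxl _ _)) Hn1] := yB n0 k.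
  have i_n : (i < maxn n1 i.+1)%N by exact: leq_maxr.
  have := coordB (fun i => b n0 i - b k i) _ _ i_n; rewrite -Hn1 => le.
  rewrite -(ltr_pM2r (Nx i)).
  apply: le_lt_trans le _; apply: le_lt_trans lt_eps.
  have := norm_ge0 N_norm (y n0 - y k); nra.
have Sa n (eps : R) : 0 < eps -> exists n0 : nat, forall k, (n0 <= k)%N ->
    N (S (b k) n - S a n) < eps.
  elim: n eps => [|n IHn] eps e0.
    by exists 0%N => k _; rewrite /S !big_ord0 subrr norm0.
  have e2 : 0 < eps / 2 by rewrite divr_gt0.
  have e'2 : 0 < eps / 2 / N (x n) by rewrite divr_gt0.
  have [n1 H1] := IHn _ e2; have [n2 H2] := Ha n _ e'2.
  exists (maxn n1 n2) => k; rewrite geq_max => /andP[/H1 lt1 /H2 lt2].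
  have -> : S (b k) n.+1 - S a n.+1
      = (S (b k) n - S a n) + (b k n - a n) *: x n.
    by rewrite /S !big_ord_recr /= scalerBl opprD addrACA.
  apply: le_lt_trans (is_normD N_norm _ _) _.
  rewrite (is_normZ N_norm) distrC [eps]splitr ltrD//.
  by rewrite -ltr_pdivlMr.
exists a; split.
  apply/norm_null_seqP => // eps e0.
  have B1 : 0 < 2 * B + 2 by lra.
  have e'0 : 0 < eps / (2 * B + 2) by rewrite divr_gt0.
  have [n0 H] := y_cauchy _ e'0.
  have [n1 H1] := Hb n0.
  exists (maxn n0 n1) => n; rewrite geq_max => /andP[n0n n1n].
  have [n2 H2] := Sa n _ e'0.
  set k := maxn n2 n.
  have lt1 : N (y n - y n0) < eps / (2 * B + 2) by apply: H; rewrite leqnn.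
  have lt2 : N (y k - y n) < eps / (2 * B + 2).
    by apply: H; rewrite n0n leq_maxr.
  have lt3 : N (S (b k) n - S a n) < eps / (2 * B + 2).
    by apply: H2; exact: leq_maxl.
  have -> : y n - S a n = (y n - y n0) + (S (b n0) n - S (b n) n)
      + ((S (b n) n - S (b k) n) + (S (b k) n - S a n)).
    by rewrite -(H1 n n1n) !addrA !subrK.
  have le1 := projBy n0 n n; have le2 := projBy n k n.
  rewrite norm_distC// in lt1; rewrite norm_distC// in lt2.
  apply: le_lt_trans (is_normD N_norm _ _) _.
  apply: le_lt_trans (lerD (is_normD N_norm _ _) (is_normD N_norm _ _)) _.
  rewrite (norm_distC _ (y n))//.
  have -> : eps = eps / (2 * B + 2) * (2 * B + 2) by rewrite divfK ?gt_eqF.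
  nra.
move=> a' /norm_null_seqP-/(_ N_norm) Ha'.
apply/funext => i; apply/eqP; rewrite -subr_eq0 -normr_le0.
rewrite -(pmulr_lle0 _ (Nx i)); apply/ler_addgt0Pl => eps e0; rewrite addr0.
have B1 : 0 < 2 * B * B + 6 * B + 1 by nra.
have e'0 : 0 < eps / (2 * B * B + 6 * B + 1) by rewrite divr_gt0.
have [n1 H1] := Ha' _ e'0; have [n0 H] := y_cauchy _ e'0.
have [n2 H2] := Hb n0.
pose n := maxn (maxn n0 n1) (maxn n2 i.+1).
have le0 : (n0 <= n)%N by rewrite /n; lia.
have le1 : (n1 <= n)%N by rewrite /n; lia.
have le2 : (n2 <= n)%N by rewrite /n; lia.
have le3 : (i < n)%N by rewrite /n; lia.
have [n3 H3] := Sa n _ e'0.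
pose k := maxn n3 n0.
have lt3 : N (S (b k) n - S a n) < eps / (2 * B * B + 6 * B + 1).
  by apply: H3; exact: leq_maxl.
have lt2 : N (y k - y n0) < eps / (2 * B * B + 6 * B + 1).
  by apply: H; rewrite leqnn leq_maxr.
have lt1 : N (y n - y n0) < eps / (2 * B * B + 6 * B + 1) by apply: H; rewrite leqnn.
have lt0 := H1 _ le1; rewrite -/(S a' n) in lt0.
have := coordB (fun i => a i - a' i) _ _ le3; rewrite -SB.
have -> : S a n - S a' n = (S a n - S (b k) n) + (S (b k) n - S (b n0) n)
    + ((y n0 - y n) + (y n - S a' n)).
  by rewrite -(H2 _ le2) !addrA !subrK.
move=> /le_trans; apply.
have := is_normD N_norm (S a n - S (b k) n + (S (b k) n - S (b n0) n))
  ((y n0 - y n) + (y n - S a' n)).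
have := is_normD N_norm (S a n - S (b k) n) (S (b k) n - S (b n0) n).
have := is_normD N_norm (y n0 - y n) (y n - S a' n).
have := projBy k n0 n.
rewrite (norm_distC _ (S a n))// (norm_distC _ (y n0))//.
set e := eps / _ in lt0 lt1 lt2 lt3 *.
have -> : eps = e * (2 * B * B + 6 * B + 1) by rewrite divfK ?gt_eqF.
move: (N (y k - y n0)) lt2 => t2 lt2 le4 le5 le6 le7.
have : B * t2 <= B * e by rewrite ler_wpM2l// ltW.
move=> le8; apply: (@le_trans _ _ (2 * B * (3 * e + B * e))).
  by apply: ler_wpM2l; lra.
have -> : 2 * B * (3 * e + B * e) = e * (2 * B * B + 6 * B) by ring.
by rewrite ler_pM2l// lerDl.
Qed.

Lemma rearrangement_cauchy a :
  (forall eps : R, 0 < eps -> exists n0 : nat, forall n (A : pred nat),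
     N (\sum_(n0 <= i < n | A i) a i *: x i) < eps) ->
  forall p : nat -> nat, bijective p ->
    norm_cauchy N (fun n => \sum_(i < n) a (p i) *: x (p i)).
Proof.
move=> tail p [q pK qK]; apply/norm_cauchyP => // eps e0.
have [n0 H] := tail _ e0.
exists (\max_(j < n0) (q j)).+1 => m n /andP[max_m mn].
rewrite (sum_ordB (fun i => a (p i) *: x (p i)))//.
pose M := (\max_(i < n) p i).+1.
rewrite -(big_map p xpredT (fun j => a j *: x j)).
have /(perm_big _) -> : perm_eq [seq p i | i <- index_iota m n]
    [seq j <- index_iota n0 M | (m <= q j < n)%N].
  apply: uniq_perm.
  - by rewrite map_inj_uniq ?iota_uniq//; exact: can_inj pK.
  - by rewrite filter_uniq// iota_uniq.
  move=> j; rewrite mem_filter mem_index_iota; apply/mapP/andP.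
    move=> [i]; rewrite mem_index_iota => im ->; rewrite pK im; split=> //.
    case/andP: im => mi i_n; rewrite ltnS (leq_bigmax (Ordinal i_n)) andbT.
    rewrite leqNgt; apply/negP => pn0.
    have := leq_bigmax (F := fun j : 'I_n0 => q j) (Ordinal pn0).
    by rewrite /= pK leqNgt (leq_trans max_m mi).
  by move=> [jm _]; exists (q j); rewrite ?mem_index_iota ?qK.
by rewrite big_filter; exact: H.
Qed.

Lemma unconditional_of_bounded_suppressions (B : R) :
  (forall i, x i != 0) ->
  (forall a n (A : pred nat),
     N (\sum_(i < n | A i) a i *: x i) <= B * N (\sum_(i < n) a i *: x i)) ->
  unconditional N x.
Proof.
move=> x0 supprB; split.
  apply: (@schauder_basic_of_bounded_projections B) => // a m n mn.
  rewrite (big_ord_widen_cond n xpredT (fun i => a i *: x i) mn) /=.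
  exact: (supprB _ _ (fun i => (i < m)%N)).
move=> a /norm_cauchyP-/(_ N_norm) ca p p_bij.
apply: rearrangement_cauchy p p_bij => eps e0.
have B1 : 0 < `|B| + 1 by rewrite ltr_wpDl.
have e'0 : 0 < eps / (`|B| + 1) by rewrite divr_gt0.
have [n0 H] := ca _ e'0; exists n0 => n A.
have [n0n|/ltnW nn0] := leqP n0 n; last by rewrite big_geq// norm0.
have /H : (n0 <= n0 <= n)%N by rewrite leqnn.
rewrite (sum_ordB (fun i => a i *: x i))//.
pose a' i := if (n0 <= i)%N then a i else 0.
have E (P : pred nat) : \sum_(n0 <= i < n | P i) a i *: x i
    = \sum_(i < n | P i) a' i *: x i.
  rewrite -(big_mkord P (fun i => a' i *: x i)) (big_cat_nat (leq0n n0) n0n)//=.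
  rewrite [X in _ = X + _]big_nat_cond [X in _ = X + _]big1 ?add0r.
    rewrite big_nat_cond [RHS]big_nat_cond; apply: eq_bigr => i.
    by case/andP=> /andP[ni _] _; rewrite /a' ni.
  by move=> i /andP[/andP[_ ni] _]; rewrite /a' leqNgt ni scale0r.
rewrite !E ltr_pdivlMr// => /(le_lt_trans _); apply.
apply: le_trans (supprB _ _ _) _; rewrite mulrC.
apply: ler_wpM2l; first exact: norm_ge0.
by rewrite (le_trans (ler_norm _))// lerDl.
Qed.

End Basis.


Section Rearrangement.
Variables (R : realType) (V : lmodType R) (N : V -> R) (N_norm : is_norm N).

(* If the sums over [A] were not Cauchy, there would be successive blocks
   [t k, t k.+1) on each of which they oscillate; the permutation moves, within
   each of these blocks, the elements of [A] to the front. *)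
Lemma subsum_cauchy (F : nat -> V) :
  (forall p : nat -> nat, bijective p ->
     norm_cauchy N (fun n => \sum_(i < n) F (p i))) ->
  forall (A : pred nat) (eps : R), 0 < eps ->
    exists n0 : nat, forall m n, (n0 <= m <= n)%N ->
      N (\sum_(m <= i < n | A i) F i) < eps.
Proof.
move=> uncond A eps e0; apply: contrapT => /forallNP noC.
have /choice[f Hf] : forall n0 : nat, exists mn : nat * nat,
    (n0 <= mn.1 <= mn.2)%N /\ eps <= N (\sum_(mn.1 <= i < mn.2 | A i) F i).
  move=> n0; have /existsNP[m /existsNP[n /not_implyP[mn /negP]]] := noC n0.
  by rewrite -leNgt; exists (m, n).
pose t := fix t k := if k is k'.+1 then (f (t k')).2 else 0%N.
pose m k := (f (t k)).1.
pose G k := [seq i <- index_iota (m k) (t k.+1) | A i].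
pose G' k := [seq i <- index_iota (m k) (t k.+1) | ~~ A i].
pose L := fix L k := if k is k'.+1
  then (L k' ++ index_iota (t k') (m k')) ++ (G k' ++ G' k') else [::].
have tm k : (t k <= m k <= t k.+1)%N by have [] := Hf (t k).
have t_lt k : (t k < t k.+1)%N.
  rewrite ltn_neqAle; have /andP[tm1 tm2] := tm k.
  rewrite (leq_trans tm1 tm2) andbT; apply: contraPneq e0 => tE.
  have [_] := Hf (t k); rewrite big_geq ?norm0//; first by lra.
  by rewrite -[X in (X <= _)%N]/(t k.+1) -tE.
have t_ge k : (k <= t k)%N by elim: k => // k IH; exact: leq_ltn_trans (t_lt k).
have permL k : perm_eq (L k) (index_iota 0 (t k)).
  elim: k => [//|k IHk].
  have /andP[tm1 tm2] := tm k.
  have iotaE a b c : (a <= b <= c)%N ->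
      index_iota a c = index_iota a b ++ index_iota b c.
    case/andP=> ab bc; rewrite /index_iota.
    have -> : (c - a = (b - a) + (c - b))%N by lia.
    by rewrite iotaD subnKC.
  rewrite (iotaE 0%N (t k)) ?(ltnW (t_lt k))//.
  rewrite (iotaE (t k) (m k)) ?tm1// catA.
  apply: perm_cat; first by rewrite perm_cat2r.
  by rewrite perm_filterC.
have sizeL k : size (L k) = t k by rewrite (perm_size (permL k)) size_iota subn0.
have uniqL k : uniq (L k) by rewrite (perm_uniq (permL k)) iota_uniq.
have memL k j : (j \in L k) = (j < t k)%N.
  by rewrite (perm_mem (permL k)) mem_index_iota.
have t_homo j k : (j <= k)%N -> (t j <= t k)%N.
  by apply: (homo_leq leqnn leq_trans) => {}k; exact: ltnW.
have nthL j k i : (j <= k)%N -> (i < t j)%N -> nth 0%N (L k) i = nth 0%N (L j) i.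
  move=> jk ij; elim: k jk => [|k IHk]; first by rewrite leqn0 => /eqP ->.
  rewrite leq_eqVlt => /predU1P[->//|jk]; rewrite -IHk//=.
  by rewrite -catA nth_cat sizeL (leq_trans ij)// t_homo.
pose p i := nth 0%N (L i.+1) i.
have pE k i : (i < t k)%N -> p i = nth 0%N (L k) i.
  move=> ik; have /orP[ik1|ki1] := leq_total i.+1 k.
    by rewrite (nthL _ _ _ ik1).
  by rewrite /p (nthL _ _ _ ki1).
have p_bij : bijective p.
  exists (fun j => index j (L j.+1)) => i.
    pose k := maxn i.+1 (p i).+1.
    have ik : (i < t k)%N by apply: leq_trans (t_ge _); exact: leq_maxl.
    have pk : (p i < t (p i).+1)%N by exact: t_ge.
    have idx : (index (p i) (L (p i).+1) < t (p i).+1)%N.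
      by rewrite -sizeL index_mem memL.
    have idxk := leq_trans idx (t_homo _ _ (leq_maxr i.+1 (p i).+1)).
    apply/eqP; rewrite -(nth_uniq 0%N _ _ (uniqL k)) ?sizeL//.
    rewrite -!pE// (pE _ _ idx) nth_index// memL.
    exact: pk.
  have ij : (i < t i.+1)%N by exact: t_ge.
  by rewrite (pE i.+1) ?nth_index ?memL// -sizeL index_mem memL.
have sumL k n : (n <= t k)%N -> \sum_(i < n) F (p i) = \sum_(j <- take n (L k)) F j.
  move=> nk; rewrite -(big_mkord xpredT (fun i => F (p i))).
  rewrite -(big_map p xpredT F); congr (\big[_/_]_(_ <- _) _).
  apply: (@eq_from_nth _ 0%N) => [|i].
    by rewrite size_map size_iota subn0 size_takel// sizeL.
  rewrite size_map size_iota subn0 => i_n.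
  rewrite (nth_map 0%N) ?size_iota ?subn0// nth_iota ?subn0// add0n nth_take// (pE k)//.
  exact: leq_trans i_n nk.
have /norm_cauchyP-/(_ N_norm _ e0)[n0 H] := uncond _ p_bij.
pose k := n0.
have szm : size (L k ++ index_iota (t k) (m k)) = m k.
  by rewrite size_cat sizeL size_iota subnKC//; have /andP[] := tm k.
have : (m k + size (G k) <= t k.+1)%N.
  by rewrite -[X in (_ <= X)%N]sizeL /= [X in (_ <= X)%N]size_cat szm leq_add2l size_cat leq_addr.
move=> mG.
have := H (m k) (m k + size (G k))%N.
rewrite leq_addr andbT (leq_trans (t_ge _)); last by have /andP[] := tm k.
rewrite !(sumL k.+1)//; last by have /andP[] := tm k.
have -> : take (m k) (L k.+1) = L k ++ index_iota (t k) (m k).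
  exact: take_size_cat.
have -> : take (m k + size (G k)) (L k.+1)
    = (L k ++ index_iota (t k) (m k)) ++ G k.
  by rewrite /= (catA _ (G k)) take_size_cat// size_cat szm.
rewrite big_cat /= [X in X - _]addrC addrK big_filter.
move=> /(_ isT) lt; have [_] := Hf (t k); rewrite leNgt => /negP; exact.
Qed.

End Rearrangement.


(** * Spreads of polynomials *)

Section Spread.
Variable R : realType.
Implicit Types (p q Z : {poly R}) (s t : nat -> nat).

Definition spread s p : {poly R} := \sum_(j < size p) p`_j *: 'X^(s j).

Lemma spread_widen n s p : (size p <= n)%N ->
  spread s p = \sum_(j < n) p`_j *: 'X^(s j).
Proof.
move=> pn; rewrite /spread (big_ord_widen n (fun j => p`_j *: 'X^(s j)) pn).
rewrite big_mkcond; apply: eq_bigr => j _ /=; case: ltnP => // pj.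
by rewrite nth_default// scale0r.
Qed.

Lemma spread_linear s : linear (spread s).
Proof.
move=> a p q; pose n := maxn (size p) (size q).
have pn : (size p <= n)%N by exact: leq_maxl.
have qn : (size q <= n)%N by exact: leq_maxr.
have pqn : (size (a *: p + q)%R <= n)%N.
  rewrite (leq_trans (size_polyD _ _))// geq_max qn andbT.
  exact: leq_trans (size_scale_leq _ _) pn.
rewrite !(@spread_widen n)// scaler_sumr -big_split; apply: eq_bigr => j _.
by rewrite coefD coefZ scalerDl scalerA.
Qed.

HB.instance Definition _ s :=
  GRing.isLinear.Build R {poly R} {poly R} _ (spread s) (spread_linear s).

Lemma spreadXn s n : spread s 'X^n = 'X^(s n).
Proof.
rewrite /spread size_polyXn big_ord_recr /= coefXn eqxx scale1r big1 ?add0r//.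
by move=> i _; rewrite coefXn ltn_eqF// scale0r.
Qed.

Lemma eq_spread s t p : (forall i, (i < size p)%N -> s i = t i) ->
  spread s p = spread t p.
Proof. by move=> st; apply: eq_bigr => i _; rewrite st. Qed.

Lemma spread_comp s t p : spread s (spread t p) = spread (s \o t) p.
Proof.
by rewrite {2}/spread linear_sum; apply: eq_bigr => i _; rewrite linearZ /= spreadXn.
Qed.

Lemma spread_shift s k l Z :
  (forall j, (j < size Z)%N -> s (k + j)%N = (l + j)%N) ->
  spread s ('X^k * Z) = 'X^l * Z.
Proof.
move=> skl; rewrite -{1}(coefK Z) poly_def mulr_sumr linear_sum.
rewrite -[in RHS](coefK Z) poly_def mulr_sumr; apply: eq_bigr => j _.
by rewrite -!scalerAr linearZ /= -!exprD spreadXn skl.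
Qed.

Lemma spread_addn k p : spread (addn k) p = 'X^k * p.
Proof. by rewrite -(@spread_shift (addn k) 0 k)// expr0 mul1r. Qed.

Definition spreading_bound (M : {poly R} -> R) (C : R) :=
  0 < C /\ forall s, {homo s : m n / (m < n)%N} ->
    forall p, M (spread s p) <= C * M p /\ M p <= C * M (spread s p).

Lemma homo_ltn_succ s : (forall i, (s i < s i.+1)%N) ->
  {homo s : m n / (m < n)%N}.
Proof. by move=> H m n; apply: (homo_ltn ltn_trans). Qed.

Definition agree k s t := forall i, (i < k)%N -> s i = t i.

(* Baire category argument in the space of increasing sequences: otherwise, bad
   finite prefixes could be extended forever, and their limit would be bad for
   every constant. *)
Lemma uniform_spreading_cylinder (M : {poly R} -> R) :
  is_norm M ->
  (forall s, {homo s : m n / (m < n)%N} -> exists C : R,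
    forall p, M (spread s p) <= C * M p /\ M p <= C * M (spread s p)) ->
  exists s0 k (C : R), {homo s0 : m n / (m < n)%N} /\
    forall s, {homo s : m n / (m < n)%N} -> agree k s s0 ->
    forall p, M (spread s p) <= C * M p /\ M p <= C * M (spread s p).
Proof.
move=> M_norm M_spr; apply: contrapT => noC.
pose good s (C : R) := forall p, M (spread s p) <= C * M p /\
  M p <= C * M (spread s p).
pose incr s := {homo s : m n / (m < n)%N}.
have /choice[f Hf] (x : (nat -> nat) * nat * nat) : exists y : (nat -> nat) * nat,
    incr x.1.1 -> [/\ incr y.1, agree x.1.2 y.1 x.1.1, (x.1.2 < y.2)%N &
      forall s, agree y.2 s y.1 -> ~ good s x.2%:R].
  move: x => [[s0 k] j] /=.
  have [s0h|] := pselect (incr s0); last by exists (s0, k).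
  move: noC => /forallNP/(_ s0)/forallNP/(_ k)/forallNP/(_ j%:R)/not_andP[//|].
  move=> /existsNP[s /not_implyP[sh /not_implyP[ag /existsNP[p bad]]]].
  exists (s, maxn k.+1 (size p)) => _; split=> //=; first exact: leq_maxl.
  move=> t ts gt; apply: bad.
  have <- : spread t p = spread s p; last exact: gt.
  by apply: eq_spread => i ip; rewrite ts// (leq_trans ip)// leq_maxr.
pose S := fix S j := if j is j'.+1 then f (S j', j') else (id, 0%N).
have S_incr j : incr (S j).1.
  by elim: j => [//|j IH]; have [] := Hf (S j, j) IH.
have S_agree j : agree (S j).2 (S j.+1).1 (S j).1.
  by have [] := Hf (S j, j) (S_incr j).
have S_lt j : ((S j).2 < (S j.+1).2)%N.
  by have [] := Hf (S j, j) (S_incr j).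
have S_bad j s : agree (S j.+1).2 s (S j.+1).1 -> ~ good s j%:R.
  by have [_ _ _] := Hf (S j, j) (S_incr j); exact.
have S_ge j : (j <= (S j).2)%N by elim: j => // j IH; exact: leq_ltn_trans (S_lt j).
have S_homo i j : (i <= j)%N -> ((S i).2 <= (S j).2)%N.
  by apply: (homo_leq (f := fun j => (S j).2) leqnn leq_trans) => k; exact: ltnW.
have S_agree' i j : (i <= j)%N -> agree (S i).2 (S j).1 (S i).1.
  elim: j => [|j IH]; first by rewrite leqn0 => /eqP ->.
  rewrite leq_eqVlt => /predU1P[->//|ij] n nk.
  by rewrite S_agree ?IH// (leq_trans nk)// S_homo.
pose s i := (S i.+1).1 i.
have s_agree j : agree (S j).2 s (S j).1.
  move=> i ij; rewrite /s; have [le|le] := leqP i.+1 j.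
    by rewrite (S_agree' _ _ le).
  by rewrite (S_agree' _ _ (ltnW le)).
have sh : incr s.
  apply: homo_ltn_succ => i; have := S_incr i.+2 _ _ (ltnSn i).
  by rewrite -!(s_agree i.+2)// ?S_ge// (leq_trans _ (S_ge _))//.
have [C HC] := M_spr s sh.
have /(_ (s_agree _)) := S_bad (Num.trunc `|C|).+1 s.
apply=> p; have CC : C <= (Num.trunc `|C|).+1%:R.
  by rewrite (le_trans (ler_norm C))// ltW// truncnS_gt.
have [H1 H2] := HC p; split.
  by rewrite (le_trans H1)// ler_wpM2r// norm_ge0.
by rewrite (le_trans H2)// ler_wpM2r// norm_ge0.
Qed.

Lemma uniform_spreading (M : {poly R} -> R) :
  is_norm M ->
  (forall s, {homo s : m n / (m < n)%N} -> exists C : R,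
    forall p, M (spread s p) <= C * M p /\ M p <= C * M (spread s p)) ->
  exists C, spreading_bound M C.
Proof.
move=> M_norm M_spr.
have [s0 [k [C0 [s0h HC]]]] := uniform_spreading_cylinder M_norm M_spr.
have addn_homo m : {homo addn m : i j / (i < j)%N}.
  by move=> i j; rewrite ltn_add2l.
have M0 p : 0 <= M p by exact: norm_ge0.
have [Ck Hk] := M_spr _ (addn_homo k).
pose m := s0 k; have [Cm Hm] := M_spr _ (addn_homo m).
pose K := `|C0| + `|Ck| + `|Cm| + 1.
have K1 : 1 <= K by rewrite lerDr !addr_ge0.
have K0 : 0 < K by lra.
have C0K : C0 <= K.
  by have := ler_norm C0; have := normr_ge0 Ck; have := normr_ge0 Cm; rewrite /K; lra.
have CkK : Ck <= K.
  by have := ler_norm Ck; have := normr_ge0 C0; have := normr_ge0 Cm; rewrite /K; lra.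
have CmK : Cm <= K.
  by have := ler_norm Cm; have := normr_ge0 Ck; have := normr_ge0 C0; rewrite /K; lra.
exists (K * K * K); split; first by rewrite !mulr_gt0.
move=> s' s'h p.
pose s j := if (j < k)%N then s0 j else (m + s' (j - k))%N.
have sh : {homo s : m n / (m < n)%N}.
  apply: homo_ltn_succ => i; rewrite /s; case: (ltnP i k) => ik.
    case: (ltnP i.+1 k) => ik1; first exact: s0h.
    have -> : i.+1 = k by lia.
    by rewrite subnn (leq_trans (s0h _ _ ik))// leq_addr.
  by rewrite ifN -?leqNgt ?(leq_trans ik)// ltn_add2l subSn//; exact: s'h.
have [||H1 H2] := HC s _ _ ('X^k * p); [exact: sh|by move=> i; rewrite /s => ->|].
have E : spread s ('X^k * p) = spread (addn m) (spread s' p).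
  rewrite -spread_addn !spread_comp; apply: eq_spread => i _ /=.
  by rewrite /s ltnNge leq_addr /= addKn.
rewrite E in H1 H2.
have [Hk1 Hk2] := Hk p; rewrite spread_addn in Hk1 Hk2.
have [Hm1 Hm2] := Hm (spread s' p).
have step (a b c : R) : 0 <= b -> a <= c * b -> c <= K -> a <= K * b.
  by move=> b0 H ?; apply: le_trans H _; exact: ler_wpM2r.
move: H1 H2 Hk1 Hk2 Hm1 Hm2.
move=> /step-/(_ (M0 _) C0K) H1 /step-/(_ (M0 _) C0K) H2.
move=> /step-/(_ (M0 _) CkK) H3 /step-/(_ (M0 _) CkK) H4.
move=> /step-/(_ (M0 _) CmK) H5 /step-/(_ (M0 _) CmK) H6.
have KW a b : a <= b -> K * a <= K * b by move=> ?; rewrite ler_pM2l.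
split; rewrite -!mulrA.
  by rewrite (le_trans H6)// KW// (le_trans H1)// KW.
by rewrite (le_trans H4)// KW// (le_trans H2)// KW.
Qed.

End Spread.


(** * Averages of shifts *)

Lemma ler_addgt0_invn (R : realType) (x y K : R) :
  (forall n : nat, (0 < n)%N -> x <= y + K / n%:R) -> x <= y.
Proof.
move=> H; apply/ler_addgt0Pr => e e0.
pose n := (Num.trunc (`|K| / e)).+1.
have n0 : 0 < n%:R :> R by rewrite ltr0n.
apply: le_trans (H n _) _ => //; rewrite lerD2l ler_pdivrMr//.
rewrite (le_trans (ler_norm K))// mulrC -ler_pdivrMr// ltW// truncnS_gt//.
Qed.

Lemma invn_small (R : realType) (K e : R) : 0 < e ->
  exists n0 : nat, forall n, (n0 <= n)%N -> K / n%:R < e.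
Proof.
move=> e0; exists (Num.trunc (`|K| / e)).+1 => n n0n.
have n0 : 0 < n%:R :> R by rewrite ltr0n (leq_trans _ n0n).
rewrite ltr_pdivrMr// (le_lt_trans (ler_norm K))// mulrC -ltr_pdivrMr//.
by rewrite (lt_le_trans (truncnS_gt _))// ler_nat.
Qed.

Section Convexity.
Variables (R : realType) (V : lmodType R) (N : V -> R) (N_norm : is_norm N).

Lemma norm_convex (I : eqType) (r : seq I) (c : I -> R) (v : I -> V) u B :
  (forall j, j \in r -> 0 <= c j) -> \sum_(j <- r) c j = 1 ->
  (forall j, j \in r -> N (u + v j) <= B) ->
  N (u + \sum_(j <- r) c j *: v j) <= B.
Proof.
move=> c0 c1 vB; rewrite -[u]scale1r -c1 scaler_suml -big_split /=.
under eq_bigr do rewrite -scalerDr.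
apply: le_trans (norm_sum N_norm _ _ _) _.
rewrite -[B]mul1r -c1 mulr_suml big_seq [leRHS]big_seq; apply: ler_sum => j jr.
rewrite (is_normZ N_norm) ger0_norm ?c0//.
by apply: ler_wpM2l; [exact: c0 | exact: vB].
Qed.

Lemma norm_convex_choice (I : eqType) n (r : nat -> seq I) (c : nat -> I -> R)
    (v : nat -> I -> V) u B :
  (forall i j, j \in r i -> 0 <= c i j) ->
  (forall i, \sum_(j <- r i) c i j = 1) ->
  (forall f, (forall i, f i \in r i) ->
     N (u + \sum_(i < n) v i (f i)) <= B) ->
  N (u + \sum_(i < n) \sum_(j <- r i) c i j *: v i j) <= B.
Proof.
move=> c0 c1; elim: n u => [|n IHn] u vB.
  rewrite big_ord0.
  have f i : {j | j \in r i}.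
    apply: cid; case: (r i) (c1 i) => [|j s _]; last by exists j; rewrite mem_head.
    by rewrite big_nil => /eqP; rewrite eq_sym oner_eq0.
  have := vB (fun i => sval (f i)) (fun i => svalP (f i)).
  by rewrite big_ord0.
rewrite big_ord_recr /= [X in u + X]addrC addrA; apply: IHn => f fr.
rewrite addrAC; apply: norm_convex => // [j|j jr]; first exact: c0.
pose f' i := if i == n then j else f i.
have := vB f'; rewrite big_ord_recr /= /f' eqxx addrA.
under eq_bigr => i _ do rewrite (ltn_eqF (ltn_ord i)).
by apply=> i; case: eqP => [->|].
Qed.

End Convexity.

Section Averages.
Variables (R : realType) (M : {poly R} -> R) (M_norm : is_norm M).
Variables (C : R) (M_spr : spreading_bound M C).
Implicit Types (p q : {poly R}) (k d l n : nat -> nat) (Z : nat -> {poly R}).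

Lemma spr_gt0 : 0 < C. Proof. by case: M_spr. Qed.

Lemma spr_le s p : {homo s : m n / (m < n)%N} -> M (spread s p) <= C * M p.
Proof. by move=> /(proj2 M_spr)/(_ p)[]. Qed.

Lemma spr_ge s p : {homo s : m n / (m < n)%N} -> M p <= C * M (spread s p).
Proof. by move=> /(proj2 M_spr)/(_ p)[]. Qed.

Lemma shift_le h p : M ('X^h * p) <= C * M p.
Proof. by rewrite -spread_addn spr_le// => i j; rewrite ltn_add2l. Qed.

Lemma shift_ge h p : M p <= C * M ('X^h * p).
Proof. by rewrite -spread_addn spr_ge// => i j; rewrite ltn_add2l. Qed.

Lemma block_spread m k d Z :
  (forall i, (k i + size (Z i) <= k i.+1)%N) ->
  {homo d : i j / (i <= j)%N} ->
  M (\sum_(i < m) 'X^(k i + d i) * Z i) <= C * M (\sum_(i < m) 'X^(k i) * Z i)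
  /\ M (\sum_(i < m) 'X^(k i) * Z i)
     <= C * M (\sum_(i < m) 'X^(k i + d i) * Z i).
Proof.
move=> kZ dh.
have kh : {homo k : i j / (i <= j)%N}.
  apply: (homo_leq leqnn leq_trans) => i.
  by rewrite (leq_trans _ (kZ i))// leq_addr.
pose idx j := (\sum_(i < m) (k i.+1 <= j))%N.
pose s j := (j + d (idx j))%N.
have sh : {homo s : i j / (i < j)%N}.
  move=> i j ij; rewrite /s -addSn leq_add// dh//.
  apply: leq_sum => i' _; case: (leqP (k i'.+1) i) => // le.
  by rewrite (leq_trans le (ltnW ij)).
have sE i j : (i < m)%N -> (j < size (Z i))%N ->
    s (k i + j)%N = (k i + d i + j)%N.
  move=> im jZ; rewrite /s addnAC; congr (_ + d _ + _)%N.
  rewrite /idx (eq_bigr (fun i' : 'I_m => if (i' < i)%N then 1%N else 0%N)).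
    rewrite -big_mkcond -(big_ord_widen m (fun=> 1%N)) ?(ltnW im)//.
    by rewrite sum1_card card_ord.
  move=> i' _; have [i'i|ii'] := ltnP i' i.
    by rewrite (leq_trans (kh _ _ i'i))// leq_addr.
  rewrite leqNgt (leq_trans _ (kh i.+1 i'.+1 _))//.
  by rewrite (leq_trans _ (kZ i))// ltn_add2l.
have E : \sum_(i < m) 'X^(k i + d i) * Z i
    = spread s (\sum_(i < m) 'X^(k i) * Z i).
  rewrite linear_sum; apply: eq_bigr => i _ /=.
  by rewrite (@spread_shift _ s _ (k i + d i)%N)// => j; exact: sE.
by rewrite E; split; [exact: spr_le|exact: spr_ge].
Qed.

Definition avg m : {poly R} := m%:R^-1 *: \sum_(t < m) 'X^t.

Lemma avg1 : avg 1 = 1.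
Proof. by rewrite /avg big_ord1 invr1 scale1r expr0. Qed.

Lemma horner_avg m : (0 < m)%N -> (avg m).[1] = 1.
Proof.
move=> m0; rewrite hornerZ horner_sum (eq_bigr (fun=> 1)).
  by rewrite sumr_const card_ord mulVf// pnatr_eq0 -lt0n.
by move=> i _; rewrite hornerXn expr1n.
Qed.

Lemma size_avg m : (size (avg m) <= m)%N.
Proof.
rewrite (leq_trans (size_scale_leq _ _))//.
rewrite (leq_trans (size_sum _ _ _))//; apply/bigmax_leqP => i _.
by rewrite size_polyXn.
Qed.

Lemma avg_choice m l n Z (B : R) :
  (forall i, (0 < n i)%N) ->
  (forall f, (forall i, (f i < n i)%N) ->
     M (\sum_(i < m) 'X^(l i + f i) * Z i) <= B) ->
  M (\sum_(i < m) 'X^(l i) * (avg (n i) * Z i)) <= B.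
Proof.
move=> n0 vB; rewrite -[X in M X]add0r.
rewrite (eq_bigr (fun i : 'I_m => \sum_(t <- index_iota 0 (n i))
   (n i)%:R^-1 *: ('X^(l i + t) * Z i))).
  apply: (norm_convex_choice M_norm (r := fun i => index_iota 0 (n i))
    (c := fun i _ => (n i)%:R^-1) (v := fun i t => 'X^(l i + t) * Z i)).
  - by move=> i _ _; rewrite invr_ge0.
  - move=> i; rewrite big_mkord sumr_const card_ord -[_ *+ n i]mulr_natr mulVf//.
    by rewrite pnatr_eq0 -lt0n.
  move=> f fn; rewrite add0r; apply: vB => i.
  by have := fn i; rewrite mem_index_iota.
move=> i _; rewrite big_mkord /avg -scalerAl -scalerAr mulr_suml mulr_sumr.
by rewrite scaler_sumr; apply: eq_bigr => t _; rewrite exprD mulrA.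
Qed.

Lemma avg_spread m k l n Z :
  (forall i, (k i + size (Z i) <= k i.+1)%N) ->
  (forall i, (0 < n i)%N) ->
  (k 0 <= l 0)%N ->
  (forall i, (l i + n i + k i.+1 <= (l i.+1).+1 + k i)%N) ->
  M (\sum_(i < m) 'X^(l i) * (avg (n i) * Z i))
    <= C * M (\sum_(i < m) 'X^(k i) * Z i).
Proof.
move=> kZ n0 kl0 kl; apply: avg_choice => // f fn.
have kle i : (k i <= l i)%N.
  elim: i => // i IHi; have := kl i; have := n0 i; lia.
pose d i := (l i + f i - k i)%N.
have dh : {homo d : i j / (i <= j)%N}.
  apply: (homo_leq leqnn leq_trans) => i; rewrite /d.
  by have := kl i; have := fn i; have := kle i; have := kle i.+1; lia.
rewrite (eq_bigr (fun i : 'I_m => 'X^(k i + d i) * Z i)).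
  exact: (block_spread _ kZ dh).1.
by move=> i _; rewrite /d subnKC// (leq_trans (kle i))// leq_addr.
Qed.

Lemma avg_null (z : {poly R}) : z.[1] = 0 ->
  exists2 K : R, 0 <= K & forall h (n : nat), (0 < n)%N -> M ('X^h * (avg n * z)) <= K / n%:R.
Proof.
move=> /eqP/factor_theorem[q ->]; exists (2 * C * M q).
  by rewrite !mulr_ge0 ?(ltW spr_gt0)// (norm_ge0 M_norm).
move=> h n n0.
have -> : 'X^h * (avg n * (q * ('X - 1%:P)))
    = n%:R^-1 *: ('X^(h + n) * q - 'X^h * q).
  rewrite polyC1 /avg -scalerAl -scalerAr exprD; congr (_ *: _).
  have -> : 'X^h * 'X^n * q - 'X^h * q = 'X^h * (('X^n - 1) * q) by ring.
  by rewrite subrX1; ring.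
rewrite (is_normZ M_norm) ger0_norm ?invr_ge0// mulrC ler_pM2r ?invr_gt0 ?ltr0n//.
apply: le_trans (normB M_norm _ _) _.
by have := shift_le (h + n) q; have := shift_le h q; lra.
Qed.

Lemma bounded_suppressions_of_balanced_blocks (z : {poly R}) (H m : nat)
    (a : nat -> R) (A : pred nat) :
  z.[1] = 0 -> (size z <= H)%N ->
  M (\sum_(i < m | A i) a i *: ('X^(H * i) * z))
    <= C * C * M (\sum_(i < m) a i *: ('X^(H * i) * z)).
Proof.
move=> z1 zH; have [K K0 HK] := avg_null z1.
apply: (@ler_addgt0_invn _ _ _ (C * (\sum_(i < m) `|a i| * K))) => n n0.
pose Z i := a i *: z.
pose Z' i := if A i then Z i else 0.
have sizeZ i : (H * i + size (Z i) <= H * i.+1)%N.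
  by rewrite mulnS addnC leq_add2r (leq_trans (size_scale_leq _ _)).
have sizeZ' i : (H * i + size (Z' i) <= H * i.+1)%N.
  rewrite /Z'; case: ifP => // _; rewrite size_poly0 addn0.
  by rewrite leq_mul2l leqnSn orbT.
have -> : \sum_(i < m | A i) a i *: ('X^(H * i) * z)
    = \sum_(i < m) 'X^(H * i) * Z' i.
  rewrite big_mkcond; apply: eq_bigr => i _; rewrite /Z' /Z.
  by case: ifP; rewrite ?mulr0// scalerAr.
have dh : {homo muln n : i j / (i <= j)%N} by move=> i j; rewrite leq_mul2l orbC => ->.
apply: le_trans (block_spread m sizeZ' dh).2 _.
rewrite -[C * C * _]mulrA -[C * _ / _]mulrA -mulrDr ler_pM2l ?spr_gt0//.
pose N' i := if A i then 1%N else n.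
have -> : \sum_(i < m) 'X^(H * i + n * i) * Z' i
  = \sum_(i < m) 'X^(H * i + n * i) * (avg (N' i) * Z i)
    - \sum_(i < m | ~~ A i) a i *: ('X^(H * i + n * i) * (avg n * z)).
  rewrite [X in _ - X]big_mkcond /= -sumrB; apply: eq_bigr => i _.
  rewrite /Z' /N' /Z; case: ifP => _ /=; first by rewrite avg1 mul1r subr0.
  by rewrite mulr0 -!scalerAr subrr.
apply: le_trans (normB M_norm _ _) _; apply: lerD.
  have -> : \sum_(i < m) a i *: ('X^(H * i) * z) = \sum_(i < m) 'X^(H * i) * Z i.
    by apply: eq_bigr => i _; rewrite /Z scalerAr.
  apply: (@avg_spread m (muln H) (fun i => H * i + n * i)%N N' Z) => //.
  - by rewrite /N' => i; case: ifP.
  - by rewrite muln0.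
  by move=> i; rewrite /N'; case: ifP => _; rewrite !mulnS; lia.
apply: le_trans (norm_sum M_norm _ _ _) _.
rewrite mulr_suml big_mkcond; apply: ler_sum => i _.
case: ifP => _; last by rewrite !mulr_ge0 ?invr_ge0.
by rewrite (is_normZ M_norm) -mulrA ler_wpM2l// HK.
Qed.

End Averages.


(** * The summing functional *)

Section SumFunctional.
Variables (R : realType) (M : {poly R} -> R) (M_norm : is_norm M).
Variables (C : R) (M_spr : spreading_bound M C).
Implicit Types (p q : {poly R}).

Let C0 : 0 < C := spr_gt0 M_spr.

Lemma bounded_suppressions_of_small_sum1 :
  (forall e : R, 0 < e -> exists2 p, p.[1] = 1 & M p < e) ->
  forall m (a : nat -> R) (A : pred nat),
  M (\sum_(i < m | A i) a i *: 'X^i)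
    <= C * (C * C * C) * M (\sum_(i < m) a i *: 'X^i).
Proof.
move=> small m a A.
pose K := \sum_(i < m) `|a i| * C.
have K0 : 0 <= K by apply: sumr_ge0 => i _; rewrite mulr_ge0// ltW.
apply: (@ler_addgt0_invn _ _ _ (C * (C * C + 1) * K)) => n n0.
have n0' : 0 < n%:R^-1 :> R by rewrite invr_gt0 ltr0n.
have [x x1 Mx] := small _ n0'.
pose z := 1 - x; pose H := (size z).+1.
have z1 : z.[1] = 0 by rewrite hornerD hornerN x1 hornerC subrr.
have Hh : {homo muln H : i j / (i < j)%N} by move=> i j; rewrite ltn_pmul2l.
have spE (P : pred nat) : spread (muln H) (\sum_(i < m | P i) a i *: 'X^i)
    = \sum_(i < m | P i) a i *: 'X^(H * i).
  by rewrite linear_sum; apply: eq_bigr => i _; rewrite linearZ /= spreadXn.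
have sumx (P : pred nat) :
    M (\sum_(i < m | P i) a i *: ('X^(H * i) * x)) <= K / n%:R.
  apply: le_trans (norm_sum M_norm _ _ _) _.
  rewrite /K mulr_suml big_mkcond; apply: ler_sum => i _.
  case: ifP => _; last by rewrite !mulr_ge0 ?(ltW n0')// ltW.
  rewrite (is_normZ M_norm) -mulrA ler_wpM2l//.
  apply: le_trans (shift_le M_spr _ _) _; rewrite ler_pM2l//.
  exact: ltW.
have sumE (P : pred nat) : \sum_(i < m | P i) a i *: ('X^(H * i) * z)
    = \sum_(i < m | P i) a i *: 'X^(H * i)
      - \sum_(i < m | P i) a i *: ('X^(H * i) * x).
  by rewrite -sumrB; apply: eq_bigr => i _; rewrite -scalerBr /z mulrBr mulr1.
have le1 := spr_ge M_spr (\sum_(i < m | A i) a i *: 'X^i) Hh.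
have le2 := spr_le M_spr (\sum_(i < m) a i *: 'X^i) Hh.
rewrite spE in le1; rewrite (spE xpredT) in le2.
have le3 : M (\sum_(i < m | A i) a i *: 'X^(H * i))
    <= M (\sum_(i < m | A i) a i *: ('X^(H * i) * z)) + K / n%:R.
  apply: le_trans (norm_le_sub M_norm _
    (\sum_(i < m | A i) a i *: ('X^(H * i) * x))) _.
  by rewrite -sumE lerD2l; exact: (sumx A).
have le4 : M (\sum_(i < m) a i *: ('X^(H * i) * z))
    <= M (\sum_(i < m) a i *: 'X^(H * i)) + K / n%:R.
  rewrite (sumE xpredT); apply: le_trans (normB M_norm _ _) _.
  by rewrite lerD2l; exact: (sumx xpredT).
have le5 := bounded_suppressions_of_balanced_blocks M_norm M_spr m a A z1
  (leqnSn (size z)).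
apply: le_trans le1 _; rewrite -!mulrA -mulrDr ler_pM2l//.
apply: le_trans le3 _.
rewrite mulrDl mul1r addrA lerD2r; apply: le_trans le5 _.
rewrite -!mulrA -!mulrDr !ler_pM2l//; apply: le_trans le4 _.
by rewrite lerD2r.
Qed.

Lemma bounded_sum :
  ~ (forall e : R, 0 < e -> exists2 p, p.[1] = 1 & M p < e) ->
  exists D : R, 0 < D /\ forall p, `|p.[1]| <= D * M p.
Proof.
move=> /existsNP[e /not_implyP[e0 noP]].
have e0' : 0 < e^-1 by rewrite invr_gt0.
exists e^-1; split=> // p; rewrite leNgt; apply/negP => lt_p.
have p1 : p.[1] != 0.
  apply: contraTneq lt_p => ->; rewrite normr0 -leNgt mulr_ge0 ?(ltW e0')//.
  exact: norm_ge0.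
apply: noP; exists (p.[1]^-1 *: p); first by rewrite hornerZ mulVf.
rewrite (is_normZ M_norm) normfV mulrC ltr_pdivrMr ?normr_gt0//.
by rewrite mulrC -ltr_pdivrMr// mulrC.
Qed.

Lemma avg_le h n : M ('X^h * avg R n) <= C * C * M 1.
Proof.
rewrite -mulrA; apply: le_trans (shift_le M_spr _ _) _; rewrite ler_pM2l//.
case: n => [|n].
  rewrite /avg big_ord0 scaler0 (norm0 M_norm) mulr_ge0// ?(ltW C0)//.
  exact: norm_ge0.
have := @avg_choice _ _ M_norm 1 (fun=> 0%N) (fun=> n.+1) (fun=> 1) (C * M 1).
rewrite big_ord1 expr0 mul1r mulr1; apply=> // f _.
by rewrite big_ord1 add0n; exact: shift_le.
Qed.

Section Bounded.
Variables (D : R) (D0 : 0 < D) (M_D : forall p, `|p.[1]| <= D * M p).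

Lemma avg_two_blocks k p n n' b : (0 < n)%N -> (0 < n')%N -> (n + k <= b.+1)%N ->
  M (avg R n * take_poly k p + 'X^b * (avg R n' * drop_poly k p)) <= C * M p.
Proof.
move=> n0 n'0 nb.
pose kk i := match i with 0 => 0%N | 1 => k | _ => (k + size (drop_poly k p))%N end.
pose Z i := match i with 0 => take_poly k p | 1 => drop_poly k p | _ => 0 end.
pose l i := match i with 0 => 0%N | i'.+1 => (b + i' * (n' + size (drop_poly k p)))%N end.
pose N i := match i with 0 => n | _ => n' end.
have := @avg_spread _ _ M_norm _ M_spr 2 kk l N Z.
rewrite !big_ord_recl !big_ord0 /= /bump /= expr0 !mul1r !addr0.
rewrite ['X^k * _]mulrC (poly_take_drop k p) add0n mul0n addn0; apply=> //.
- case=> [|[|i]] //=; last by rewrite size_poly0 addn0.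
  exact: size_take_poly.
- by case.
case=> [|[|i]] //=; rewrite ?mulSn; lia.
Qed.

Lemma averages_cauchy :
  (forall e : R, 0 < e ->
     exists k p, (take_poly k p).[1] = 1 /\ M p < e) ->
  norm_cauchy M (fun n => avg R n.+1).
Proof.
move=> small; apply/norm_cauchyP => // e e0.
have M1 : 0 <= M 1 by exact: norm_ge0.
pose K := C + D * (C * C * M 1).
have K0 : 0 < K by rewrite ltr_pwDl// !mulr_ge0// ltW.
have eK : 0 < e / 8 / K by rewrite !divr_gt0.
have [k [p [y1 Mp]]] := small _ eK.
have [K1 K10 HK1] : exists2 K1 : R, 0 <= K1 & forall h n, (0 < n)%N ->
    M ('X^h * (avg R n * (take_poly k p - 1))) <= K1 / n%:R.
  by apply: (avg_null M_norm M_spr); rewrite hornerD hornerN y1 hornerC subrr.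
set z := drop_poly k p.
have [K2 K20 HK2] : exists2 K2 : R, 0 <= K2 & forall h n, (0 < n)%N ->
    M ('X^h * (avg R n * (z - z.[1]%:P))) <= K2 / n%:R.
  by apply: (avg_null M_norm M_spr); rewrite hornerD hornerN hornerC subrr.
have e8 : 0 < e / 8 by rewrite divr_gt0.
have [n1 Hn1] := invn_small K1 e8; have [n2 Hn2] := invn_small K2 e8.
have z1 : z.[1] + 1 = p.[1].
  by rewrite -(poly_take_drop k p) hornerD y1 hornerM hornerXn expr1n mulr1 addrC.
have far n n' b : (0 < n)%N -> (0 < n')%N -> (n + k <= b.+1)%N ->
    (n1 <= n)%N -> (n2 <= n')%N -> M (avg R n - 'X^b * avg R n') < e / 2.
  move=> n0 n'0 nb n1n n2n'.
  have -> : avg R n - 'X^b * avg R n' =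
      (avg R n * take_poly k p + 'X^b * (avg R n' * z))
      - 'X^0 * (avg R n * (take_poly k p - 1))
      - ('X^b * (avg R n' * (z - z.[1]%:P))
         + p.[1] *: ('X^b * avg R n')).
    by rewrite -z1 -mul_polyC expr0 polyCD polyC1; ring.
  apply: le_lt_trans (normB M_norm _ _) _.
  apply: le_lt_trans (lerD (normB M_norm _ _) (is_normD M_norm _ _)) _.
  have le1 := avg_two_blocks p n0 n'0 nb.
  have le2 := HK1 0%N n n0; have le3 := HK2 b n' n'0.
  have le4 := avg_le b n'.
  have lt1 := Hn1 _ n1n; have lt2 := Hn2 _ n2n'.
  have le5 : M (p.[1] *: ('X^b * avg R n')) <= D * M p * (C * C * M 1).
    by rewrite (is_normZ M_norm) ler_pM// norm_ge0.
  have : K * M p < e / 8 by rewrite mulrC -ltr_pdivlMr.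
  have -> : K * M p = C * M p + D * M p * (C * C * M 1) by rewrite /K; ring.
  by rewrite -/z in le1; lra.
exists (n1 + n2)%N => m n mn.
pose b := (n + m + k)%N.
have -> : avg R n.+1 - avg R m.+1 = (avg R n.+1 - 'X^b * avg R n2.+1)
    - (avg R m.+1 - 'X^b * avg R n2.+1) by ring.
apply: le_lt_trans (normB M_norm _ _) _.
have [n0n n0m] : (n1 <= n.+1)%N /\ (n1 <= m.+1)%N by move: mn; clear; lia.
by rewrite [e]splitr ltrD//; apply: far; rewrite ?n0n ?n0m//; rewrite /b; clear; lia.
Qed.

Lemma take_sum_bounded : schauder_basic M (fun i => 'X^i) ->
  exists B : R, 0 < B /\ forall k p, `|(take_poly k p).[1]| <= B * M p.
Proof.
move=> M_basic; apply: contrapT => noB.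
have avg_cauchy : norm_cauchy M (fun n => avg R n.+1).
  apply: averages_cauchy => e e0; apply: contrapT => noP; apply: noB.
  have e0' : 0 < e^-1 by rewrite invr_gt0.
  exists e^-1; split=> // k p; rewrite leNgt; apply/negP => lt_p.
  pose y := take_poly k p.
  have p1 : y.[1] != 0.
    apply: contraTneq lt_p; rewrite -/y => ->.
    by rewrite normr0 -leNgt mulr_ge0 ?(ltW e0') ?(norm_ge0 M_norm).
  apply: noP; exists k, (y.[1]^-1 *: p); split.
    by rewrite take_polyZ hornerZ mulVf.
  rewrite (is_normZ M_norm) normfV mulrC ltr_pdivrMr ?normr_gt0//.
  by rewrite mulrC -ltr_pdivrMr// mulrC.
have [|a [/norm_null_seqP-/(_ M_norm) aP a_uniq]] := M_basic _ _ avg_cauchy.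
  move=> k; exists k.+1, (fun=> k.+1%:R^-1).
  by rewrite /avg scaler_sumr.
pose a' i := if i is i'.+1 then a i' else 0.
have /a_uniq aa' : M (avg R n.+1 - \sum_(i < n) a' i *: 'X^i) @[n --> \oo] --> (0 : R).
  apply/norm_null_seqP => // e e0.
  have e3 : 0 < e / 3 by rewrite divr_gt0.
  have e3C : 0 < e / 3 / C by rewrite divr_gt0.
  have [n1 H1] := aP _ e3C.
  have [K K0 HK] : exists2 K : R, 0 <= K & forall h n, (0 < n)%N ->
      M ('X^h * (avg R n * (1 - 'X))) <= K / n%:R.
    by apply: (avg_null M_norm M_spr); rewrite hornerD hornerN hornerC hornerX subrr.
  have [n2 H2] := invn_small K e3.
  move/norm_cauchyP : avg_cauchy => /(_ M_norm _ e3)[n3 H3].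
  exists (n1 + n2 + n3).+1 => -[//|n]; rewrite ltnS => len.
  rewrite big_ord_recl /= scale0r add0r.
  rewrite (eq_bigr (fun i : 'I_n => 'X * (a i *: 'X^i))); last first.
    by move=> i _; rewrite /= exprS scalerAr.
  rewrite -mulr_sumr.
  have -> : avg R n.+2 - 'X * \sum_(i < n) a i *: 'X^i
    = (avg R n.+2 - avg R n.+1) + ('X^0 * (avg R n.+1 * (1 - 'X))
      + 'X^1 * (avg R n.+1 - \sum_(i < n) a i *: 'X^i)).
    by rewrite expr0 expr1; ring.
  apply: le_lt_trans (is_normD M_norm _ _) _.
  apply: le_lt_trans (lerD (lexx _) (is_normD M_norm _ _)) _.
  have lt1 : M (avg R n.+2 - avg R n.+1) < e / 3 by apply: H3; lia.
  have lt2 : M ('X^0 * (avg R n.+1 * (1 - 'X))) < e / 3.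
    by apply: le_lt_trans (HK _ _ _) (H2 _ _) => //; lia.
  have lt3 : M ('X^1 * (avg R n.+1 - \sum_(i < n) a i *: 'X^i)) < e / 3.
    apply: le_lt_trans (shift_le M_spr _ _) _.
    by rewrite mulrC -ltr_pdivlMr//; apply: H1; lia.
  have -> : e = e / 3 + (e / 3 + e / 3) by field.
  by rewrite !ltrD.
have a0 i : a i = 0 by elim: i => [|i IHi]; rewrite aa'.
have D0' : 0 < D^-1 by rewrite invr_gt0.
have [n /(_ n (leqnn n))] := aP _ D0'.
rewrite big1 ?subr0; last by move=> i _; rewrite a0 scale0r.
have := M_D (avg R n.+1); rewrite horner_avg// normr1 => le1 lt1.
have : D * M (avg R n.+1) < D * D^-1 by rewrite ltr_pM2l.
by rewrite divff ?gt_eqF//; lra.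
Qed.

Lemma bounded_projections : schauder_basic M (fun i => 'X^i) ->
  exists B : R, 0 < B /\ forall k p, M (take_poly k p) <= B * M p.
Proof.
move=> /take_sum_bounded[B' [B'0 HB']].
have M1 : 0 <= M 1 by exact: norm_ge0.
pose E := C * C * M 1.
have E0 : 0 <= E by rewrite !mulr_ge0// ltW.
exists (C + (D + B') * E); split.
  by rewrite ltr_pwDl// mulr_ge0// addr_ge0// ltW.
move=> k p; set y := take_poly k p; set z := drop_poly k p.
have [K K0 HK] : exists2 K : R, 0 <= K & forall h n, (0 < n)%N ->
    M ('X^h * (avg R n * (z - z.[1]%:P))) <= K / n%:R.
  by apply: (avg_null M_norm M_spr); rewrite hornerD hornerN hornerC subrr.
apply: (@ler_addgt0_invn _ _ _ K) => n n0.
have le1 : M (y + 'X^k * (avg R n * z)) <= C * M p.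
  by have := @avg_two_blocks k p 1 n k isT n0; rewrite avg1 mul1r; apply; lia.
have -> : y = (y + 'X^k * (avg R n * z))
    - ('X^k * (avg R n * (z - z.[1]%:P)) + z.[1] *: ('X^k * avg R n)).
  by rewrite -mul_polyC; ring.
have z1 : `|z.[1]| <= (D + B') * M p.
  have -> : z.[1] = p.[1] - y.[1].
    rewrite -[in RHS](poly_take_drop k p) hornerD hornerM hornerXn expr1n mulr1.
    by rewrite -/y -/z addrC addKr.
  apply: le_trans (ler_normB _ _) _; rewrite mulrDl lerD//.
  exact: HB'.
apply: le_trans (normB M_norm _ _) _.
apply: le_trans (lerD (lexx _) (is_normD M_norm _ _)) _.
have le2 := HK k n n0.
have le3 : M (z.[1] *: ('X^k * avg R n)) <= (D + B') * M p * E.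
  by rewrite (is_normZ M_norm) ler_pM// ?norm_ge0//; exact: avg_le.
have -> : (C + (D + B') * E) * M p = C * M p + (D + B') * M p * E by ring.
by lra.
Qed.

End Bounded.
End SumFunctional.


(** * The unconditional and the convex block homogeneous parts *)

Section EventualSup.
Variable R : realType.
Implicit Types (u v : nat -> R).

(* The limit superior of a bounded sequence ([inf] is a junk value otherwise). *)
Definition evsup u : R :=
  inf [set c | exists n0 : nat, forall n, (n0 <= n)%N -> u n <= c].

Lemma evsup_le u (c : R) n0 : (forall n, 0 <= u n) ->
  (forall n, (n0 <= n)%N -> u n <= c) -> evsup u <= c.
Proof.
move=> u0 uc; apply: ge_inf; last by exists n0.
exists 0 => d [n1 ud]; exact: le_trans (u0 n1) (ud _ (leqnn _)).
Qed.

Lemma evsup_ge u (b c : R) n0 : (forall n, u n <= b) ->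
  (forall n, (n0 <= n)%N -> c <= u n) -> c <= evsup u.
Proof.
move=> ub cu; apply: lb_le_inf; first by exists b, 0%N.
move=> d [n1 ud]; apply: le_trans (cu (maxn n0 n1) _) (ud _ _).
  exact: leq_maxl.
exact: leq_maxr.
Qed.

Lemma evsup_adherent u (b e : R) : (forall n, 0 <= u n <= b) -> 0 < e ->
  exists n0 : nat, forall n, (n0 <= n)%N -> u n <= evsup u + e.
Proof.
move=> ub e0; have [|c [n0 uc] /ltW cle] := @inf_adherent _
  [set c | exists n0 : nat, forall n, (n0 <= n)%N -> u n <= c] _ e0.
  split; first by exists b, 0%N => n _; have /andP[] := ub n.
  exists 0 => d [n1 ud]; apply: le_trans (ud _ (leqnn _)).
  by have /andP[] := ub n1.
by exists n0 => n n0n; apply: le_trans (uc _ n0n) cle.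
Qed.

Lemma evsup_scale u v (b K : R) n0 :
  (forall n, 0 <= u n) -> (forall n, 0 <= v n <= b) -> 0 <= K ->
  (forall n, (n0 <= n)%N -> u n <= K * v n) -> evsup u <= K * evsup v.
Proof.
move=> u0 vb K0 uv; apply/ler_addgt0Pr => e e0.
have K1 : 0 < K + 1 by lra.
have [n1 vn1] := evsup_adherent vb (divr_gt0 e0 K1).
apply: (@evsup_le _ _ (maxn n0 n1)) => // n; rewrite geq_max => /andP[n0n n1n].
apply: le_trans (uv _ n0n) _.
apply: le_trans (ler_wpM2l K0 (vn1 _ n1n)) _.
rewrite mulrDr lerD2l mulrCA -[leRHS]mulr1 ler_pM2l// ler_pdivrMr//.
by rewrite mul1r lerDl.
Qed.

Lemma evsupD u v w (b : R) : (forall n, 0 <= u n) ->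
  (forall n, 0 <= v n <= b) -> (forall n, 0 <= w n <= b) ->
  (forall n, u n <= v n + w n) -> evsup u <= evsup v + evsup w.
Proof.
move=> u0 vb wb uvw; apply/ler_addgt0Pr => e e0.
have e2 : 0 < e / 2 by rewrite divr_gt0.
have [n1 vn1] := evsup_adherent vb e2; have [n2 wn2] := evsup_adherent wb e2.
apply: (@evsup_le _ _ (maxn n1 n2)) => // n; rewrite geq_max => /andP[n1n n2n].
have := uvw n; have := vn1 _ n1n; have := wn2 _ n2n; lra.
Qed.

End EventualSup.

Section Blocks.
Variable R : realType.
Implicit Types (p z : {poly R}) (s : nat -> nat).

Lemma spreadME s p z : spread s p * z = \sum_(i < size p) p`_i *: ('X^(s i) * z).
Proof. by rewrite mulr_suml; apply: eq_bigr => i _; rewrite scalerAl. Qed.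

Lemma spread_sumX s m (a : nat -> R) (P : pred nat) :
  spread s (\sum_(i < m | P i) a i *: 'X^i) = \sum_(i < m | P i) a i *: 'X^(s i).
Proof. by rewrite linear_sum; apply: eq_bigr => i _; rewrite linearZ /= spreadXn. Qed.

Lemma horner_spread1 s p : (spread s p).[1] = p.[1].
Proof.
rewrite horner_sum horner_coef; apply: eq_bigr => i _.
by rewrite hornerZ hornerXn !expr1n.
Qed.

Lemma spread_blocks (H : nat) s z : (0 < H)%N -> (size z <= H)%N ->
  {homo s : m n / (m < n)%N} ->
  exists2 s', {homo s' : m n / (m < n)%N} &
    forall p, spread (muln H) (spread s p) * z = spread s' (spread (muln H) p * z).
Proof.
move=> H0 zH sh; exists (fun j => H * s (j %/ H) + j %% H)%N.
  move=> i j ij; have := leq_div2r H (ltnW ij).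
  rewrite leq_eqVlt => /predU1P[E|lt].
    by rewrite E ltn_add2l; move: ij; rewrite {1}(divn_eq i H) {1}(divn_eq j H) E ltn_add2l.
  apply: (@leq_trans (H * (s (i %/ H)).+1)%N).
    by rewrite mulnS addnC ltn_add2r ltn_pmod.
  by rewrite (leq_trans _ (leq_addr _ _))// leq_mul2l sh// orbT.
move=> p; rewrite spread_comp !spreadME linear_sum; apply: eq_bigr => i _.
rewrite linearZ /=; congr (_ *: _); rewrite (@spread_shift _ _ _ (H * s i)%N)//.
move=> j jz; have jH := leq_trans jz zH.
by rewrite [(H * i)%N]mulnC divnMDl// divn_small// addn0 modnMDl modn_small.
Qed.

End Blocks.

Section Parts.
Variables (R : realType) (M : {poly R} -> R) (M_norm : is_norm M).
Variables (C : R) (M_spr : spreading_bound M C).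
Implicit Types (p q : {poly R}).

Let C0 : 0 < C := spr_gt0 M_spr.
Let M0 p : 0 <= M p := norm_ge0 M_norm p.

Definition u_part p : R := M (spread (muln 2) p * (1 - 'X)).

Let size_1X : (size (1 - 'X : {poly R})%R <= 2)%N.
Proof. by rewrite (leq_trans (size_polyD _ _))// size_polyN size_polyX size_poly1. Qed.

Lemma spread_eq0 s p : {homo s : m n / (m < n)%N} -> spread s p = 0 -> p = 0.
Proof.
move=> sh sp; apply: (is_norm0_eq0 M_norm); apply/eqP.
rewrite eq_le M0 andbT; apply: le_trans (spr_ge M_spr p sh) _.
by rewrite sp norm0// mulr0.
Qed.

Lemma muln_homo n : (0 < n)%N -> {homo muln n : i j / (i < j)%N}.
Proof. by move=> n0 i j; rewrite ltn_pmul2l. Qed.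

Lemma u_part_norm : is_norm u_part.
Proof.
split=> [p q|a p|p].
- by rewrite /u_part linearD /= mulrDl; exact: is_normD.
- by rewrite /u_part linearZ /= -scalerAl; exact: is_normZ.
move=> /(is_norm0_eq0 M_norm)/eqP; rewrite mulf_eq0 => /orP[/eqP|].
  exact/spread_eq0/muln_homo.
by rewrite subr_eq0 => /eqP/(congr1 (fun q : {poly R} => q`_1)) /eqP;
  rewrite coefX coef1 eq_sym oner_eq0.
Qed.

Lemma u_part_suppressions m (a : nat -> R) (A : pred nat) :
  u_part (\sum_(i < m | A i) a i *: 'X^i)
    <= C * C * u_part (\sum_(i < m) a i *: 'X^i).
Proof.
rewrite /u_part spread_sumX (spread_sumX _ _ _ xpredT) !mulr_suml.
have := @bounded_suppressions_of_balanced_blocks _ _ M_norm _ M_spr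
  (1 - 'X) 2 m a A.
rewrite hornerD hornerN hornerC hornerX subrr => /(_ erefl size_1X).
under eq_bigr do rewrite scalerAl; under [X in _ * M X]eq_bigr do rewrite scalerAl.
exact.
Qed.

Lemma u_part_spreading s p : {homo s : m n / (m < n)%N} ->
  u_part (spread s p) <= C * u_part p /\ u_part p <= C * u_part (spread s p).
Proof.
move=> sh; have [s' s'h E] := spread_blocks (isT : 0 < 2)%N size_1X sh.
by rewrite /u_part E; split; [exact: spr_le | exact: spr_ge].
Qed.

Lemma u_part_le p : u_part p <= (C + C * C) * M p.
Proof.
rewrite /u_part mulrBr mulr1 mulrDl mulrC.
apply: le_trans (normB M_norm _ _) _.
have le1 := spr_le M_spr p (muln_homo (isT : 0 < 2)%N).
apply: lerD => //; rewrite -['X]expr1 -mulrA.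
apply: le_trans (shift_le M_spr _ _) _; rewrite ler_pM2l//.
Qed.

Definition block_avg n p : {poly R} := spread (muln (2 * n)) p * avg R n.

Definition c_part p : R := evsup (fun n => M (block_avg n p)).

Lemma block_avgD n p q : block_avg n (p + q) = block_avg n p + block_avg n q.
Proof. by rewrite /block_avg linearD mulrDl. Qed.

Lemma block_avgZ n (a : R) p : block_avg n (a *: p) = a *: block_avg n p.
Proof. by rewrite /block_avg linearZ scalerAl. Qed.

Lemma block_avg_sumX n m (a : nat -> R) :
  block_avg n (\sum_(i < m) a i *: 'X^i)
    = \sum_(i < m) 'X^(2 * n * i) * (avg R n * (a i)%:P).
Proof.
rewrite /block_avg (spread_sumX _ _ _ xpredT) mulr_suml; apply: eq_bigr => i _.
by rewrite [avg R n * _]mulrC mul_polyC -scalerAl scalerAr.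
Qed.

Lemma block_avg_le n p : M (block_avg n p) <= C * M p.
Proof.
case: n => [|n].
  by rewrite /block_avg /avg big_ord0 scaler0 mulr0 norm0// mulr_ge0// ltW.
rewrite -[p]coefK poly_def block_avg_sumX.
have -> : \sum_(i < size p) p`_i *: 'X^i
    = \sum_(i < size p) 'X^i * (p`_i)%:P.
  by apply: eq_bigr => i _; rewrite mulrC mul_polyC.
apply: (@avg_spread _ _ M_norm _ M_spr _ id (muln (2 * n.+1)) (fun=> n.+1)
  (fun i => (p`_i)%:P)) => // i.
  by rewrite -addn1 leq_add2l size_polyC leq_b1.
by rewrite mulnS; lia.
Qed.

Lemma block_avg_bounds p n : 0 <= M (block_avg n p) <= C * M p.
Proof. by rewrite M0 block_avg_le. Qed.

Lemma c_part_le p : c_part p <= C * M p.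
Proof. by apply: (@evsup_le _ _ _ 0) => // n _; exact: block_avg_le. Qed.

Lemma c_part_ge0 p : 0 <= c_part p.
Proof. exact: (@evsup_ge _ _ (C * M p) _ 0%N (fun n => block_avg_le n p)). Qed.

Lemma horner_block_avg n p : (0 < n)%N -> (block_avg n p).[1] = p.[1].
Proof. by move=> n0; rewrite hornerM horner_spread1 horner_avg// mulr1. Qed.

Lemma u_c_parts_ge p : M p <= C * c_part p + C * C * u_part p.
Proof.
have key n : (0 < n)%N -> M p <= C * M (block_avg n p) + C * C * u_part p.
  move=> n0; have n20 : (0 < 2 * n)%N by rewrite muln_gt0.
  apply: le_trans (spr_ge M_spr p (muln_homo n20)) _.
  rewrite -mulrA -mulrDr ler_pM2l// addrC.
  set q := spread _ p.
  have -> : q = block_avg n p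
      + \sum_(t <- index_iota 0 n) n%:R^-1 *: (q * (1 - 'X^t)).
    rewrite -scaler_sumr -mulr_sumr /block_avg -/q /avg -scalerAr -scalerDr -mulrDr.
    rewrite big_mkord -big_split /= (eq_bigr (fun=> 1)).
      rewrite sumr_const card_ord mulr_natr -[q *+ n]scaler_nat scalerA mulVf ?scale1r//.
      by rewrite pnatr_eq0 -lt0n.
    by move=> t _; rewrite addrC subrK.
  apply: le_trans (is_normD M_norm _ _) _. rewrite addrC lerD2l.
  rewrite -[X in M X]add0r.
  apply: (norm_convex M_norm (r := index_iota 0 n) (c := fun=> n%:R^-1)
    (v := fun t => q * (1 - 'X^t))).
  - by move=> _ _; rewrite invr_ge0.
  - rewrite big_mkord sumr_const card_ord -[_ *+ n]mulr_natr mulVf//.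
    by rewrite pnatr_eq0 -lt0n.
  move=> t; rewrite mem_index_iota add0r => /andP[_ tn].
  have [->|t0] := posnP t.
    by rewrite expr0 subrr mulr0 norm0//; exact: mulr_ge0 (ltW C0) (M0 _).
  pose s j := (2 * n * (j %/ 2) + t * (j %% 2))%N.
  have sh : {homo s : i j / (i < j)%N}.
    apply: homo_ltn_succ => j; rewrite /s.
    have jE := divn_eq j 2.
    have : (j %% 2 < 2)%N by rewrite ltn_pmod.
    case E : (j %% 2)%N => [|[|//]] _.
      have [-> ->] : (j.+1 %/ 2 = j %/ 2)%N /\ (j.+1 %% 2 = 1)%N by lia.
      by rewrite muln0 muln1 addn0 -addn1 leq_add2l.
    have [-> ->] : (j.+1 %/ 2 = (j %/ 2).+1)%N /\ (j.+1 %% 2 = 0)%N by lia.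
    by rewrite muln0 muln1 addn0 mulnS addnC ltn_add2r; lia.
  have -> : q * (1 - 'X^t) = spread s (spread (muln 2) p * (1 - 'X)).
    rewrite /q !spreadME linear_sum; apply: eq_bigr => i _.
    rewrite linearZ /= !mulrBr !mulr1 -exprSr -exprD [spread s _]linearB /=.
    rewrite !spreadXn /s; congr (_ *: _).
    have [-> ->] : ((2 * i) %/ 2 = i)%N /\ ((2 * i) %% 2 = 0)%N by lia.
    have [-> ->] : ((2 * i).+1 %/ 2 = i)%N /\ ((2 * i).+1 %% 2 = 1)%N by lia.
    by rewrite muln0 addn0 muln1.
  exact: spr_le.
rewrite -lerBlDr [C * c_part p]mulrC -ler_pdivrMr//.
apply: (@evsup_ge _ _ (C * M p) _ 1%N); first by move=> n; exact: block_avg_le.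
by move=> n n0; rewrite ler_pdivrMr// lerBlDr [M _ * C]mulrC; exact: key.
Qed.

Lemma c_part_le_blocks m (a : nat -> R) (k : nat -> nat) (Z : nat -> {poly R}) :
  (forall i, (k i + size (Z i) <= k i.+1)%N) -> (forall i, (Z i).[1] = 1) ->
  c_part (\sum_(i < m) a i *: 'X^i)
    <= C * C * M (\sum_(i < m) a i *: ('X^(k i) * Z i)).
Proof.
move=> kZ Z1; apply/ler_addgt0Pr => e e0.
have /choice[K HK] (i : nat) : exists K : R, forall h n, (0 < n)%N ->
    M ('X^h * (avg R n * (Z i - 1))) <= K / n%:R.
  have [|K _ HK] := @avg_null _ _ M_norm _ M_spr (Z i - 1); last by exists K.
  by rewrite hornerD hornerN hornerC Z1 subrr.
have [n0 Hn0] := invn_small (C * \sum_(i < m) `|a i| * K i) e0.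
apply: (@evsup_le _ _ _ (n0 + k m + 1)%N) => // n nbig.
have n_gt0 : (0 < n)%N by lia.
have kh : {homo k : i j / (i <= j)%N}.
  apply: (homo_leq leqnn leq_trans) => i.
  by rewrite (leq_trans _ (kZ i))// leq_addr.
apply: le_trans (shift_ge M_spr (2 * n) _) _.
pose Z' i := if (i < m)%N then a i *: Z i else 0.
pose k' i := minn (k i) (k m).
have -> : 'X^(2 * n) * block_avg n (\sum_(i < m) a i *: 'X^i)
  = \sum_(i < m) 'X^(2 * n * i.+1) * (avg R n * Z' i)
    - \sum_(i < m) a i *: ('X^(2 * n * i.+1) * (avg R n * (Z i - 1))).
  rewrite block_avg_sumX mulr_sumr -sumrB; apply: eq_bigr => i _.
  rewrite /Z' ltn_ord mulnS exprD -!mul_polyC; ring.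
have le1 : M (\sum_(i < m) 'X^(2 * n * i.+1) * (avg R n * Z' i))
    <= C * M (\sum_(i < m) 'X^(k' i) * Z' i).
  apply: (@avg_spread _ _ M_norm _ M_spr m k' (fun i => 2 * n * i.+1)%N (fun=> n)) => //.
  - move=> i; rewrite /k' /Z'; case: (ltnP i m) => im.
      rewrite !(minn_idPl _) ?kh//; last exact: ltnW.
      by rewrite (leq_trans _ (kZ i))// leq_add2l size_scale_leq.
    by rewrite size_poly0; have := kh _ _ im; have := kh _ _ (leqW im); lia.
  - by rewrite /k'; lia.
  by move=> i; rewrite /k' !mulnS; lia.
have E1 : \sum_(i < m) 'X^(k' i) * Z' i = \sum_(i < m) a i *: ('X^(k i) * Z i).
  apply: eq_bigr => i _; rewrite /k' /Z' ltn_ord (minn_idPl _) ?scalerAr//.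
  exact/kh/ltnW/ltn_ord.
rewrite E1 in le1.
have le2 : M (\sum_(i < m) a i *: ('X^(2 * n * i.+1) * (avg R n * (Z i - 1))))
    <= (\sum_(i < m) `|a i| * K i) / n%:R.
  apply: le_trans (norm_sum M_norm _ _ _) _; rewrite mulr_suml.
  apply: ler_sum => i _; rewrite (is_normZ M_norm) -mulrA ler_wpM2l//.
  exact: HK.
apply: le_trans (ler_wpM2l (ltW C0) (normB M_norm _ _)) _; rewrite mulrDr.
apply: lerD; first by rewrite -mulrA ler_pM2l.
apply: le_trans (ler_wpM2l (ltW C0) le2) _.
by rewrite mulrA ltW// Hn0//; lia.
Qed.

Section Convex.
Variables (F : nat -> {fset nat}) (c : nat -> R).
Hypothesis F_lt : forall k i j, i \in F k -> j \in F k.+1 -> (i < j)%N.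
Hypothesis c_ge0 : forall k i, i \in F k -> 0 <= c i.
Hypothesis c_sum1 : forall k, \sum_(i <- F k) c i = 1.

Let F_neq0 k : exists i, i \in F k.
Proof.
have [F0|/fset0Pn//] := eqVneq (F k) fset0.
by have := c_sum1 k; rewrite F0 big_seq_fset0 => /esym/eqP; rewrite oner_eq0.
Qed.

Lemma c_part_convex_block_le m (a : nat -> R) :
  c_part (\sum_(i < m) a i *: \sum_(j <- F i) c j *: 'X^j)
    <= C * c_part (\sum_(i < m) a i *: 'X^i).
Proof.
set p := \sum_(i < m) a i *: 'X^i.
apply: (@evsup_scale _ _ _ (C * M p) _ 1) => //.
- by move=> n; exact: block_avg_bounds.
- exact: ltW.
move=> n n0.
have -> : block_avg n (\sum_(i < m) a i *: \sum_(j <- F i) c j *: 'X^j)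
    = 0 + \sum_(i < m) \sum_(j <- F i) c j *: (a i *: ('X^(2 * n * j) * avg R n)).
  rewrite add0r /block_avg linear_sum mulr_suml; apply: eq_bigr => i _.
  rewrite linearZ linear_sum /= -scalerAl mulr_suml scaler_sumr.
  apply: eq_bigr => j _; rewrite linearZ /= spreadXn -scalerAl.
  by rewrite !scalerA mulrC.
apply: (norm_convex_choice M_norm (r := fun i => F i)
  (c := fun _ j => c j) (v := fun i j => a i *: ('X^(2 * n * j) * avg R n))) => //.
move=> f fF; rewrite add0r.
have fh : {homo f : i j / (i < j)%N}.
  by apply: homo_ltn_succ => i; exact: F_lt (fF i) (fF i.+1).
have n20 : (0 < 2 * n)%N by rewrite muln_gt0.
have szn : (size (avg R n) <= 2 * n)%N.
  by rewrite (leq_trans (size_avg _ _))// leq_pmull.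
have [s' s'h E] := spread_blocks n20 szn fh.
have -> : \sum_(i < m) a i *: ('X^(2 * n * f i) * avg R n)
    = spread s' (block_avg n p).
  rewrite -E /p (spread_sumX f m a xpredT) linear_sum mulr_suml.
  by apply: eq_bigr => i _; rewrite linearZ /= spreadXn scalerAl.
exact: spr_le.
Qed.

Lemma c_part_convex_block_ge m (a : nat -> R) :
  c_part (\sum_(i < m) a i *: 'X^i)
    <= C * C * c_part (\sum_(i < m) a i *: \sum_(j <- F i) c j *: 'X^j).
Proof.
set p := \sum_(i < m) a i *: 'X^i; set q := (X in _ <= _ * c_part X).
have CC : 0 < C * C by rewrite mulr_gt0.
rewrite mulrC -ler_pdivrMr//.
apply: (@evsup_ge _ _ (C * M q) _ 1%N); first by move=> n; exact: block_avg_le.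
move=> n n0; rewrite ler_pdivrMr// [_ * (C * C)]mulrC.
pose b i := if i is i'.+1 then (\max_(j <- F i') j).+1 else 0%N.
have bF i j : j \in F i -> (b i <= j < b i.+1)%N.
  move=> jF; apply/andP; split.
    case: i jF => // i jF; rewrite /b.
    have [i0 i0F] := F_neq0 i.
    have lt l : l \in F i -> (l <= j.-1)%N.
      by move=> lF; have := F_lt lF jF; case: j {jF}.
    have := F_lt i0F jF; rewrite -ltnS => j0.
    rewrite -(@prednK j); last by case: j j0 {lt jF}.
    by rewrite ltnS; apply/bigmax_leqP_seq => l lF _; exact: lt.
  by rewrite /b ltnS; exact: (@leq_bigmax_seq _ (F i : seq nat) xpredT id j jF).
pose Z i : {poly R} := \sum_(j <- F i) c j *: ('X^(2 * n * (j - b i)) * avg R n).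
have -> : block_avg n q = \sum_(i < m) a i *: ('X^(2 * n * b i) * Z i).
  rewrite /q /block_avg linear_sum mulr_suml; apply: eq_bigr => i _.
  rewrite linearZ linear_sum /= -scalerAl mulr_suml mulr_sumr; congr (_ *: _).
  rewrite big_seq [RHS]big_seq; apply: eq_bigr => j jF.
  rewrite linearZ /= spreadXn -scalerAl -[RHS]scalerAr; congr (_ *: _).
  rewrite mulrA -exprD -mulnDr subnKC//.
  by have /andP[] := bF _ _ jF.
apply: (@c_part_le_blocks m a (fun i => 2 * n * b i)%N Z) => i.
  have [j0 j0F] := F_neq0 i; have /andP[b1 b2] := bF _ _ j0F.
  have bb : (b i <= b i.+1)%N by lia.
  rewrite -(subnKC bb) mulnDr leq_add2l; apply: leq_trans (size_sum _ _ _) _.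
  apply/bigmax_leqP_seq => j jF _; apply: leq_trans (size_scale_leq _ _) _.
  have /andP[b3 b4] := bF _ _ jF.
  apply: leq_trans (size_polyMleq _ _) _; rewrite size_polyXn addSn /=.
  apply: (@leq_trans (2 * n * (j - b i).+1)%N).
    by rewrite mulnS addnC leq_add2r (leq_trans (size_avg _ _))// leq_pmull.
  by rewrite leq_mul2l; apply/orP; right; apply: ltn_sub2r => //; exact: leq_ltn_trans b3 b4.
rewrite horner_sum -[RHS](c_sum1 i); apply: eq_bigr => j _.
by rewrite hornerZ hornerM hornerXn expr1n horner_avg// !mulr1.
Qed.

End Convex.
End Parts.


Section CPart.
Variables (R : realType) (M : {poly R} -> R) (M_norm : is_norm M).
Variables (C : R) (M_spr : spreading_bound M C).
Variables (D : R) (M_D : forall p : {poly R}, `|p.[1]| <= D * M p).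
Variables (B : R) (M_B : forall k (p : {poly R}), M (take_poly k p) <= B * M p).
Hypotheses (D0 : 0 < D) (B0 : 0 < B).
Implicit Types (p q : {poly R}).

Lemma c_part_proj k p : c_part M (take_poly k p) <= B * c_part M p.
Proof.
apply: (@evsup_scale _ _ _ (C * M p) _ 1) => [n|n||n n0]; first exact: norm_ge0.
- exact: block_avg_bounds.
- exact: ltW.
suff <- : take_poly (2 * n * k) (block_avg n p) = block_avg n (take_poly k p).
  exact: M_B.
have mulE q : block_avg n (q * 'X^k) = block_avg n q * 'X^(2 * n * k).
  rewrite /block_avg [q * _]mulrC -spread_addn spread_comp mulrAC.
  rewrite [_ * 'X^_]mulrC -spread_addn spread_comp; congr (_ * _).
  by apply: eq_spread => i _ /=; rewrite mulnDr.
rewrite -{1}[p](poly_take_drop k) block_avgD mulE take_polyDMXn//.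
rewrite /block_avg spreadME; apply: leq_trans (size_sum _ _ _) _.
apply/bigmax_leqP => i _; apply: leq_trans (size_scale_leq _ _) _.
apply: leq_trans (size_polyMleq _ _) _; rewrite size_polyXn addSn /=.
apply: (@leq_trans (2 * n * i.+1)%N).
  by rewrite mulnS addnC leq_add2r (leq_trans (size_avg _ _))// leq_pmull.
by rewrite leq_mul2l (leq_trans (ltn_ord i)) ?orbT// size_take_poly.
Qed.

Lemma c_part_sum p : `|p.[1]| <= D * c_part M p.
Proof.
rewrite mulrC -ler_pdivrMr//.
apply: (@evsup_ge _ _ (C * M p) _ 1%N) => n.
  exact: block_avg_le.
by move=> n0; rewrite ler_pdivrMr// mulrC -(horner_block_avg _ n0); exact: M_D.
Qed.

Lemma c_part_norm : is_norm (c_part M).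
Proof.
have cpZ (a : R) p : c_part M (a *: p) <= `|a| * c_part M p.
  apply: (@evsup_scale _ _ _ (C * M p) _ 0) => // [n|n|n _]; first exact: norm_ge0.
    exact: block_avg_bounds.
  by rewrite block_avgZ (is_normZ M_norm).
have cp0 : c_part M 0 = 0.
  apply/eqP; rewrite eq_le (c_part_ge0 M_norm M_spr) andbT.
  by have := cpZ 0 0; rewrite scale0r normr0 mul0r.
split=> [p q|a p|p p0].
- pose b := C * M p + C * M q.
  have pb : C * M p <= b by rewrite lerDl mulr_ge0 ?(ltW (spr_gt0 M_spr)) ?norm_ge0.
  have qb : C * M q <= b by rewrite lerDr mulr_ge0 ?(ltW (spr_gt0 M_spr)) ?norm_ge0.
  apply: (@evsupD _ _ _ _ b) => n.
  + exact: norm_ge0.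
  + by have /andP[-> /le_trans->] := block_avg_bounds M_norm M_spr p n.
  + by have /andP[-> /le_trans->] := block_avg_bounds M_norm M_spr q n.
  + by rewrite block_avgD; exact: is_normD.
- apply/eqP; rewrite eq_le cpZ /=.
  have [->|a0] := eqVneq a 0; first by rewrite scale0r cp0 normr0 mul0r.
  rewrite mulrC -ler_pdivlMr ?normr_gt0// mulrC -normfV.
  by have := cpZ a^-1 (a *: p); rewrite scalerA mulVf// scale1r.
have take0 k : (take_poly k p).[1] = 0.
  apply/eqP; rewrite -normr_le0; apply: le_trans (c_part_sum _) _.
  rewrite -(mulr0 D) ler_pM2l//; apply: le_trans (c_part_proj _ _) _.
  by rewrite p0 mulr0.
apply/polyP => i; rewrite coef0; have := take0 i.+1.
rewrite /take_poly poly_def big_ord_recr /= -poly_def hornerD -/(take_poly i p).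
by rewrite take0 add0r hornerZ hornerXn expr1n mulr1.
Qed.

End CPart.

Section Conditional.
Variables (R : realType) (V : lmodType R) (N Nc : V -> R) (x : nat -> V).

Lemma unconditional_of_summing (K D E : R) :
  is_norm N -> is_norm Nc -> 0 < K -> 0 < D -> 0 < E ->
  (forall v, Nc v <= K * N v) ->
  (forall n (a : nat -> R), `|\sum_(i < n) a i| <= D * Nc (\sum_(i < n) a i *: x i)) ->
  (forall i, N (x i) <= E) ->
  schauder_basic N x -> unconditional Nc x -> unconditional N x.
Proof.
move=> N_norm Nc_norm K0 D0 E0 NcN sumNc xE N_basic [_ Nc_rearr]; split=> // a.
move=> /norm_cauchyP-/(_ N_norm) ca.
have /Nc_rearr cc : norm_cauchy Nc (fun n => \sum_(i < n) a i *: x i).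
  apply/norm_cauchyP => // e e0; have eK : 0 < e / K by rewrite divr_gt0.
  have [n0 H] := ca _ eK; exists n0 => m n /H lt.
  by apply: le_lt_trans (NcN _) _; rewrite mulrC -ltr_pdivlMr.
apply: rearrangement_cauchy => // e e0.
pose d := e / E / D / 2.
have d0 : 0 < d by rewrite !divr_gt0.
have [n1 H1] := subsum_cauchy (F := fun i => a i *: x i) Nc_norm cc (fun i => 0 <= a i) d0.
have [n2 H2] := subsum_cauchy (F := fun i => a i *: x i) Nc_norm cc (fun i => ~~ (0 <= a i)) d0.
have sumA m n (A : pred nat) : `|\sum_(m <= i < n | A i) a i|
    <= D * Nc (\sum_(m <= i < n | A i) a i *: x i).
  pose b i := if A i && (m <= i)%N then a i else 0.
  rewrite !big_geq_mkord !(big_mkcond (fun i : 'I_n => _ && _)) /=.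
  rewrite (eq_bigr (fun i : 'I_n => b i *: x i)); first exact: sumNc.
  by move=> i _; rewrite /b; case: ifP; rewrite ?scale0r.
exists (maxn n1 n2) => n A.
have [le|/ltnW ge] := leqP (maxn n1 n2) n; last by rewrite big_geq// norm0.
set m := maxn n1 n2 in le *.
have lt1 : Nc (\sum_(m <= i < n | 0 <= a i) a i *: x i) < d.
  by apply: H1; rewrite leq_maxl.
have lt2 : Nc (\sum_(m <= i < n | ~~ (0 <= a i)) a i *: x i) < d.
  by apply: H2; rewrite leq_maxr.
have le1 := sumA m n (fun i => 0 <= a i).
have le2 := sumA m n (fun i => ~~ (0 <= a i)).
apply: (@le_lt_trans _ _ ((\sum_(m <= i < n) `|a i|) * E)).
  apply: le_trans (norm_sum N_norm _ _ _) _.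
  rewrite mulr_suml big_mkcond; apply: ler_sum => i _.
  case: ifP => _; last by rewrite mulr_ge0// ltW.
  by rewrite (is_normZ N_norm) ler_wpM2l.
rewrite -ltr_pdivlMr// (bigID (fun i => 0 <= a i)) /=.
have -> : \sum_(m <= i < n | 0 <= a i) `|a i| = \sum_(m <= i < n | 0 <= a i) a i.
  by apply: eq_bigr => i a0; rewrite ger0_norm.
have -> : \sum_(m <= i < n | ~~ (0 <= a i)) `|a i|
    = - \sum_(m <= i < n | ~~ (0 <= a i)) a i.
  by rewrite -sumrN; apply: eq_bigr => i; rewrite -ltNge => a0; rewrite ltr0_norm.
apply: le_lt_trans (lerD (ler_norm _) (ler_norm _)) _; rewrite normrN.
have -> : e / E = D * d + D * d by rewrite /d; field; rewrite !gt_eqF.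
by apply: ltr_leD; [apply: le_lt_trans le1 _|apply: le_trans le2 _];
  rewrite ?ltr_pM2l// ler_pM2l// ltW.
Qed.

End Conditional.

(** * Finitely supported sequences as polynomials *)

Section C00Poly.
Variable R : realType.
Implicit Types (x y : c00 R) (p q : {poly R}).

Lemma c00_bound x : exists n : nat, forall i, (n <= i)%N -> x i = 0.
Proof.
have /asboolP/finite_seqP[s sE] := c00P x.
exists (\max_(j <- s) j).+1 => i ni; apply: contrapT => /eqP xi.
have : [set i | x i != 0] i by [].
rewrite sE /= => /(@leq_bigmax_seq _ s xpredT id i)/(_ isT) /=.
by rewrite leqNgt ni.
Qed.

Definition poly_of_c00 x : {poly R} :=
  \poly_(i < sval (cid (c00_bound x))) x i.

Lemma coef_poly_of_c00 x i : (poly_of_c00 x)`_i = x i.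
Proof.
rewrite coef_poly; case: ifPn => //; rewrite -leqNgt => /(svalP (cid (c00_bound x))).
by move=> ->.
Qed.

Lemma c00_of_poly_subproof p : (fun i => p`_i) \in @finitely_supported R.
Proof.
apply/asboolP; apply: (sub_finite_set _ (finite_II (size p))) => i /=.
by apply: contra_neqT; rewrite -leqNgt => /(nth_default 0).
Qed.

Definition c00_of_poly p : c00 R := C00 (c00_of_poly_subproof p).

Lemma c00_eqP x y : (forall i, x i = y i) -> x = y.
Proof. by move=> xy; apply: val_inj; apply/funext. Qed.

Lemma poly_of_c00_linear : linear poly_of_c00.
Proof.
move=> a x y; apply/polyP => i.
by rewrite coefD coefZ !coef_poly_of_c00.
Qed.

HB.instance Definition _ :=
  GRing.isLinear.Build R (c00 R) {poly R} _ poly_of_c00 poly_of_c00_linear.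

Lemma c00_of_poly_linear : linear c00_of_poly.
Proof. by move=> a p q; apply: c00_eqP => i /=; rewrite coefD coefZ. Qed.

HB.instance Definition _ :=
  GRing.isLinear.Build R {poly R} (c00 R) _ c00_of_poly c00_of_poly_linear.

Lemma poly_of_c00K : cancel poly_of_c00 c00_of_poly.
Proof. by move=> x; apply: c00_eqP => i; rewrite /= coef_poly_of_c00. Qed.

Lemma c00_of_polyK : cancel c00_of_poly poly_of_c00.
Proof. by move=> p; apply/polyP => i; rewrite coef_poly_of_c00. Qed.

Lemma c00_of_polyXn i : c00_of_poly 'X^i = unit_vector R i.
Proof. by apply: c00_eqP => j; rewrite /= coefXn. Qed.

Lemma poly_of_unit_vector i : poly_of_c00 (unit_vector R i) = 'X^i.
Proof. by rewrite -c00_of_polyXn c00_of_polyK. Qed.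

End C00Poly.


Lemma is_norm_comp (R : realType) (V W : lmodType R) (N : W -> R)
    (f : {linear V -> W}) : is_norm N -> injective f -> is_norm (N \o f).
Proof.
move=> N_norm f_inj; split=> [x y|a x|x] /=.
- by rewrite linearD; exact: is_normD.
- by rewrite linearZ; exact: is_normZ.
by move=> /(is_norm0_eq0 N_norm) fx0; apply: f_inj; rewrite fx0 linear0.
Qed.

Lemma take_poly_sumX (R : realType) (a : nat -> R) m n : (m <= n)%N ->
  take_poly m (\sum_(i < n) a i *: 'X^i) = \sum_(i < m) a i *: 'X^i.
Proof.
move=> mn; rewrite -!poly_def; apply/polyP => i; rewrite coef_take_poly !coef_poly.
by case: (ltnP i m) => // im; rewrite (leq_trans im mn).
Qed.

Lemma sum_unit_vector (R : realType) n (a : nat -> R) (s : nat -> nat) (P : pred nat) :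
  \sum_(i < n | P i) a i *: unit_vector R (s i)
    = c00_of_poly (\sum_(i < n | P i) a i *: 'X^(s i)).
Proof.
by rewrite linear_sum; apply: eq_bigr => i _; rewrite linearZ /= c00_of_polyXn.
Qed.

Lemma poly_of_sum_unit_vector (R : realType) n (a : nat -> R) (s : nat -> nat)
    (P : pred nat) :
  poly_of_c00 (\sum_(i < n | P i) a i *: unit_vector R (s i))
    = \sum_(i < n | P i) a i *: 'X^(s i).
Proof. by rewrite sum_unit_vector c00_of_polyK. Qed.

Lemma unit_vector_neq0 (R : realType) i : unit_vector R i != 0.
Proof.
apply/eqP => /(congr1 (@poly_of_c00 R)); rewrite poly_of_unit_vector linear0.
by move/eqP; rewrite -size_poly_eq0 size_polyXn.
Qed.

Section UnitVectorBasis.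
Variables (R : realType) (N : c00 R -> R) (N_norm : is_norm N).
Let M (p : {poly R}) := N (c00_of_poly p).

Lemma spreading_bound_of_spreading : spreading N (@unit_vector R) ->
  exists C, spreading_bound M C.
Proof.
move=> N_spr; apply: uniform_spreading => [|s /N_spr[c [C [c0 _ H]]]].
  exact: is_norm_comp N_norm (can_inj (@c00_of_polyK R)).
exists (Num.max C c^-1) => p.
have := H (size p) (fun i => p`_i).
rewrite (sum_unit_vector _ _ id xpredT) (sum_unit_vector _ _ s xpredT).
rewrite -poly_def coefK -/(spread s p) -/(M p) -/(M (spread s p)) => -[H1 H2].
have M0 q : 0 <= M q by exact: (norm_ge0 N_norm).
split; first by rewrite (le_trans H2)// ler_wpM2r// le_max lexx.
rewrite (@le_trans _ _ (c^-1 * M (spread s p)))//.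
  by rewrite mulrC ler_pdivlMr// mulrC.
by rewrite ler_wpM2r// le_max lexx orbT.
Qed.

Lemma schauder_basic_poly : schauder_basic N (@unit_vector R) ->
  schauder_basic M (fun i => 'X^i).
Proof.
move=> N_basic y y_span y_cauchy.
have [k||a [aP a_uniq]] := N_basic (fun n => c00_of_poly (y n)).
- have [n [a ->]] := y_span k; exists n, a.
  by rewrite (sum_unit_vector _ _ id xpredT).
- apply/norm_cauchyP => // e e0.
  have M_norm : is_norm M := is_norm_comp N_norm (can_inj (@c00_of_polyK R)).
  have /norm_cauchyP-/(_ M_norm _ e0)[n0 H] := y_cauchy.
  by exists n0 => m n mn; rewrite -linearB; exact: H.
have E (b : nat -> R) : (fun n => N (c00_of_poly (y n) - \sum_(i < n) b i *: unit_vector R i))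
    = (fun n => M (y n - \sum_(i < n) b i *: 'X^i)).
  by apply/funext => n; rewrite (sum_unit_vector _ _ id xpredT) -linearB.
by exists a; split=> [|b]; rewrite -E//; exact: a_uniq.
Qed.

End UnitVectorBasis.

Theorem theorem2 (R : realType) (N : c00 R -> R) (N_norm : is_norm N)
    (N_cs : conditional_spreading N (@unit_vector R)) :
  exists Nu Nc : c00 R -> R,
    [/\ is_norm Nu /\ is_norm Nc,
        subsymmetric Nu (@unit_vector R),
        conditional Nc (@unit_vector R) /\
          convex_block_homogeneous Nc (@unit_vector R) &
        exists kappa K : R, [/\ 0 < kappa, 0 < K &
          forall x : c00 R,
            kappa * Num.max (Nu x) (Nc x) <= N x /\
            N x <= K * Num.max (Nu x) (Nc x)]].
Proof.
case: N_cs => N_basic N_spr N_cond.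
pose M (p : {poly R}) := N (c00_of_poly p).
have M_norm : is_norm M.
  exact: is_norm_comp N_norm (can_inj (@c00_of_polyK R)).
have [C M_spr] := spreading_bound_of_spreading N_norm N_spr.
have C0 : 0 < C := spr_gt0 M_spr.
have N_M x : N x = M (poly_of_c00 x) by rewrite /M poly_of_c00K.
have [D [D0 M_D]] : exists D : R, 0 < D /\ forall p, `|p.[1]| <= D * M p.
  apply: (bounded_sum M_norm) => small; apply: N_cond.
  apply: (unconditional_of_bounded_suppressions N_norm
    (B := C * (C * C * C))) => [|a n A]; first exact: unit_vector_neq0.
  rewrite (sum_unit_vector _ _ id A) (sum_unit_vector _ _ id xpredT).
  exact: bounded_suppressions_of_small_sum1 M_norm _ M_spr small n a A.
have [B [B0 M_B]] := bounded_projections M_norm M_spr D0 M_D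
  (schauder_basic_poly N_norm N_basic).
have Mu_norm := u_part_norm M_norm M_spr.
have Mc_norm := c_part_norm M_norm M_spr M_D M_B D0 B0.
pose Nu x := u_part M (poly_of_c00 x).
pose Nc x := c_part M (poly_of_c00 x).
have Nu_norm : is_norm Nu.
  exact: is_norm_comp Mu_norm (can_inj (@poly_of_c00K R)).
have Nc_norm : is_norm Nc.
  exact: is_norm_comp Mc_norm (can_inj (@poly_of_c00K R)).
exists Nu, Nc; split=> //.
- split.
    apply: (unconditional_of_bounded_suppressions Nu_norm (B := C * C)) => [|a n A].
      exact: unit_vector_neq0.
    rewrite /Nu (poly_of_sum_unit_vector _ _ id A).
    rewrite (poly_of_sum_unit_vector _ _ id xpredT).
    exact: u_part_suppressions.
  move=> s sh; exists C^-1, C; rewrite invr_gt0; split=> // n a.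
  rewrite /Nu (poly_of_sum_unit_vector _ _ id xpredT).
  rewrite (poly_of_sum_unit_vector _ _ s xpredT).
  have := u_part_spreading M_spr (\sum_(i < n) a i *: 'X^i) sh.
  rewrite (spread_sumX s n a xpredT) => -[H1 H2]; split=> //.
  by rewrite mulrC ler_pdivrMr// mulrC.
- split.
    move=> Nc_unc; apply: N_cond.
    apply: (@unconditional_of_summing _ _ N Nc (unit_vector R) C D (C * M 1 + 1)) => //.
    + by rewrite ltr_wpDl// mulr_ge0// ?(ltW C0)// norm_ge0.
    + by move=> x; rewrite N_M; exact: c_part_le.
    + move=> n a; rewrite /Nc (poly_of_sum_unit_vector _ _ id xpredT).
      have := c_part_sum M_norm M_spr M_D D0 (\sum_(i < n) a i *: 'X^i).
      rewrite horner_sum (eq_bigr (fun i : 'I_n => a i))// => i _.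
      by rewrite hornerZ hornerXn expr1n mulr1.
    + move=> i; rewrite N_M poly_of_unit_vector -['X^i]mulr1.
      by apply: le_trans (shift_le M_spr i 1) _; rewrite lerDl.
  split.
    apply: (schauder_basic_of_bounded_projections Nc_norm (B := B)).
      exact: unit_vector_neq0.
    move=> a m n mn; rewrite /Nc !(poly_of_sum_unit_vector _ _ id xpredT).
    by rewrite -(take_poly_sumX _ mn); apply: c_part_proj M_spr _ M_B B0 _ _.
  move=> w [F [c [F_lt c_ge0 c_sum1 wE]]].
  exists (C * C)^-1, C; rewrite invr_gt0 mulr_gt0//; split=> // n a.
  have -> : Nc (\sum_(i < n) a i *: w i)
      = c_part M (\sum_(i < n) a i *: \sum_(j <- F i) c j *: 'X^j).
    rewrite /Nc linear_sum; congr (c_part M _); apply: eq_bigr => i _.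
    rewrite linearZ /= wE linear_sum; congr (_ *: _); apply: eq_bigr => j _.
    by rewrite linearZ /= poly_of_unit_vector.
  rewrite /Nc (poly_of_sum_unit_vector _ _ id xpredT); split.
    rewrite mulrC ler_pdivrMr ?mulr_gt0// mulrC.
    exact: c_part_convex_block_ge.
  exact: c_part_convex_block_le.
have K0 : 0 < C + C * C by rewrite addr_gt0// mulr_gt0.
exists (C + C * C)^-1, (C + C * C); rewrite invr_gt0; split=> // x.
rewrite N_M; split.
  rewrite mulrC ler_pdivrMr// mulrC ge_max /Nu u_part_le//=.
  apply: le_trans (c_part_le M_norm M_spr _) _.
  by rewrite ler_wpM2r ?norm_ge0// lerDl mulr_ge0// ltW.
apply: le_trans (u_c_parts_ge M_norm M_spr _) _; rewrite mulrDl.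
by rewrite lerD// ler_pM2l ?mulr_gt0// le_max lexx ?orbT.
Qed.
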